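(* Fix $d\in\mathbb N$. There exists a universal metastability rate $E^d_\bullet$, depending only on $d$, that applies uniformly to all sequences $(\mathrm{AV}_nT(x):n\in\mathbb N)$ of averages, where $\mathscr M$ is any (abstract) PET structure over $\mathbb Z$, $x$ is any element of the unit ball of the Hilbert space $\mathcal H^{\mathscr M}$, and $T\in(\mathscr L^\infty_{\mathbb Z,\mathfrak B})^{\mathscr M}$ is any unitary Leibman sequence of degree at most $d$ in $\mathscr M$.
   Context: Metastability rates. Let $\mathcal P^*_{\mathrm{fin}}(X)$ denote the family of finite nonempty subsets of $X$, and $\mathbb N_{\ge i}=\{j\in\mathbb N: j\ge i\}$. A sampling of $\mathbb N$ is an element $\eta\in\prod_{i\in\mathbb N}\mathcal P^*_{\mathrm{fin}}(\mathbb N_{\ge i})$. A metastability rate is a family $E_\bullet=(E_{\epsilon,\eta})$, indexed by all real $\epsilon>0$ and all samplings $\eta$, with each $E_{\epsilon,\eta}\in\mathcal P^*_{\mathrm{fin}}(\mathbb N)$. It applies to a sequence $(a_n:n\in\mathbb N)$ in a metric space with metric $\mathrm d$ if for every $\epsilon>0$ and every sampling $\eta$ there is $i\in E_{\epsilon,\eta}$ with $\max\{\mathrm d(a_j,a_k): j,k\in\eta_i\}<\epsilon$. Henson structures and logic. A Henson metric structure is a many-sorted structure whose sorts are metric spaces with a distinguished anchor point (one sort being $\mathbb R$), with distinguished constants and distinguished functions between finite products of sorts that are bounded and uniformly continuous on bounded sets; the metrics are among the functions. Positive bounded formulas are built from atomic formulas $t\le r$, $t\ge r$ ($t$ a real-valued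 term, $r\in\mathbb Q$) by $\wedge,\vee$ and bounded quantifiers $\exists_r x$ (over the closed ball of radius $r$ about the anchor) and $\forall_r x$ (over the open ball of radius $r$). An approximation of $\varphi$ is obtained by strictly relaxing all bounds ($t\le r$ to $t\le r'$ with $r'>r$; $t\ge r$ to $t\ge r'$ with $r'<r$; $\exists_r$ to $\exists_{r'}$ with $r'>r$; $\forall_r$ to $\forall_{r'}$ with $r'<r$). $\mathscr M$ approximately satisfies $\varphi$ if it satisfies every approximation of $\varphi$. The theory of a class of structures is the set of positive bounded sentences approximately satisfied by all its members; a model of a theory is a structure approximately satisfying all its sentences. Classical PET structures over $\mathbb Z$. Let $\mathcal H$ be a real Hilbert space. The sorts are: $\mathbb R,\mathbb N,\mathbb Z$; $\mathcal A_{\mathbb Z}$ (all subsets of $\mathbb Z$); $\mathcal H$; $\mathfrak B$ (bounded operators on $\mathcal H$, operator norm); $\mathfrak M$ (finite signed measures $\mu=\sum_i c_i\delta_i$ on $\mathbb Z$, norm $\sum_i|c_i|$); and the Banach spaces $\mathscr L^\infty_{X,Y}$ of bounded functions $X\to Y$ with sup norm, for $X=\mathbb Z$, $Y\in\{\mathbb R,\mathcal H,\mathfrak B,\mathfrak M\}$ and for $X=\mathbb Z^2$, $Y\in\{\mathbb R,\mathcal H,\mathfrak B\}$. The sorts $\mathbb N,\mathbb Z,\mathcal A_{\mathbb Z}$ carry the discrete metric. Below $X,Y$ range over all combinations for which the named sorts exist. Constants: all elements of $\mathbb N$ and $\mathbb Z$; all rationals in $\mathbb R$; the zero of every Banach sort;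 the identity $I\in\mathfrak B$; $\emptyset,\mathbb Z\in\mathcal A_{\mathbb Z}$. Functions: the discrete metrics; addition, subtraction, multiplication, absolute value, $\min,\max$ on $\mathbb R$; the characteristic function of $\le$ on $\mathbb N$ and of membership on $\mathbb Z\times\mathcal A_{\mathbb Z}$; the group operations of $\mathbb Z$; union, intersection, complement on $\mathcal A_{\mathbb Z}$; vector operations, inner product and norm on $\mathcal H$; addition, scalar multiplication and norm on each Banach sort; the pointwise inner product $\mathscr L^\infty_{X,\mathcal H}\times\mathscr L^\infty_{X,\mathcal H}\to\mathscr L^\infty_{X,\mathbb R}$; pointwise absolute value, $\max$, $\min$ on $\mathscr L^\infty_{X,\mathbb R}$; total variation $|\mu|=\sum_i|c_i|\delta_i$ and coefficientwise $\max,\min$ on $\mathfrak M$; pointwise norm $\mathscr L^\infty_{X,Y}\to\mathscr L^\infty_{X,\mathbb R}$; adjoint and composition on $\mathfrak B$ and, pointwise, on $\mathscr L^\infty_{X,\mathfrak B}$; the inclusions $\mathbb Z\to\mathcal A_{\mathbb Z}$ ($i\mapsto\{i\}$), $\mathcal A_{\mathbb Z}\to\mathscr L^\infty_{\mathbb Z,\mathbb R}$ ($A\mapsto\chi_A$), $\mathbb Z\to\mathfrak M$ ($i\mapsto\delta_i$), $Y\to\mathscr L^\infty_{X,Y}$ (constant functions), and $\mathscr L^\infty_{\mathbb Z,Y}\to\mathscr L^\infty_{\mathbb Z^2,Y}$ sending $f$ to $(w,x)\mapsto f(x)$, respectively to $(w,x)\mapsto f(w)$; the evaluations $\mathfrak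 B\times\mathcal H\to\mathcal H$, $\mathscr L^\infty_{X,Y}\times X\to Y$, and pointwise $\mathscr L^\infty_{X,\mathfrak B}\times\mathscr L^\infty_{X,\mathcal H}\to\mathscr L^\infty_{X,\mathcal H}$; the partial evaluations $(F,i)\mapsto F(i,\cdot)$ and $(F,j)\mapsto F(\cdot,j)$ from $\mathscr L^\infty_{\mathbb Z^2,Y}\times\mathbb Z$ to $\mathscr L^\infty_{\mathbb Z,Y}$; the map $\sigma:\mathbb N\to\mathfrak M$, $\sigma_n=\frac1{n+1}\sum_{0\le i\le n}\delta_i$; the translation action $\mathscr L^\infty_{\mathbb Z,Y}\to\mathscr L^\infty_{\mathbb Z^2,Y}$, $f\mapsto((i,j)\mapsto f(i+j))$, with ${}_if$ denoting $j\mapsto f(i+j)$; the shear $F\mapsto((i,j)\mapsto F(i,i+j))$ and the swap $F\mapsto((i,j)\mapsto F(j,i))$ on $\mathscr L^\infty_{\mathbb Z^2,Y}$; the translation action $\mathfrak M\to\mathscr L^\infty_{\mathbb Z,\mathfrak M}$, $\mu\mapsto(i\mapsto{}_i\mu)$, where ${}_i\mu=\sum_jc_j\delta_{j-i}$ for $\mu=\sum_jc_j\delta_j$; and the integrations, for $\mu=\sum_i c_i\delta_i$: $(f,\mu)\mapsto\langle f,\mu\rangle=\sum_ic_if(i)$ from $\mathscr L^\infty_{\mathbb Z,Y}\times\mathfrak M$ to $Y$; $(\mu,F)\mapsto(j\mapsto\langle F(\cdot,j),\mu\rangle)$ and $(F,\mu)\mapsto(i\mapsto\langle F(i,\cdot),\mu\rangle)$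 with values in $\mathscr L^\infty_{\mathbb Z,Y}$, for $F\in\mathscr L^\infty_{\mathbb Z^2,Y}$; and $(F,\mu_\bullet)\mapsto(j\mapsto\langle F(\cdot,j),\mu_j\rangle)$ from $\mathscr L^\infty_{\mathbb Z^2,Y}\times\mathscr L^\infty_{\mathbb Z,\mathfrak M}$ to $\mathscr L^\infty_{\mathbb Z,Y}$. Abstract PET structures. Let $\mathcal L$ be the Henson language with one sort name, constant symbol and function symbol for each item above. An (abstract) PET structure over $\mathbb Z$ is a model $\mathscr M$ of the $\mathcal L$-theory of the class of all classical PET structures over $\mathbb Z$. A superscript $\mathscr M$ denotes the interpretation of a symbol in $\mathscr M$. $\mathbb R^{\mathscr M}$ is identified with $\mathbb R$; $\mathbb N$ and $\mathbb Z$ are identified, via the constants, with subsets of $\mathbb N^{\mathscr M}$ and $\mathbb Z^{\mathscr M}$; $\mathcal H^{\mathscr M}$ is a real Hilbert space; elements $T$ of $(\mathscr L^\infty_{\mathbb Z,\mathfrak B})^{\mathscr M}$ are identified, via evaluation, with functions $i\mapsto T_i$ from $\mathbb Z^{\mathscr M}$ to $\mathfrak B^{\mathscr M}$, and elements of $\mathfrak B^{\mathscr M}$ with bounded operators on $\mathcal H^{\mathscr M}$. Leibman sequences in $\mathscr M$. For $T\in(\mathscr L^\infty_{\mathbb Z,\mathfrak B})^{\mathscr M}$ and $i\in\mathbb Z^{\mathscr M}$, let $\Delta^iT\in(\mathscr L^\infty_{\mathbb Z,\mathfrak B})^{\mathscr M}$ be given by $(\Delta^iT)_j=T_{i+j}\circ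 T_j^*$ for $j\in\mathbb Z^{\mathscr M}$. $T$ is a unitary Leibman sequence of degree at most $d$ if $T_i^*\circ T_i=I=T_i\circ T_i^*$ for all $i\in\mathbb Z^{\mathscr M}$ and $\Delta^{i_d}\cdots\Delta^{i_1}\Delta^{i_0}T$ is the constant function $I$ for all $i_0,\dots,i_d\in\mathbb Z^{\mathscr M}$. Averages. For $n\in\mathbb N^{\mathscr M}$, $\mathrm{AV}_nT=\langle T,\sigma_n\rangle\in\mathfrak B^{\mathscr M}$, and $\mathrm{AV}_nT(x)=(\mathrm{AV}_nT)(x)$. For standard $n\in\mathbb N$, $\mathrm{AV}_nT(x)=\frac1{n+1}\sum_{0\le i\le n}T_i(x)$. *)

(* Defs.v *)
From HB Require Import structures.
From mathcomp Require Import all_boot all_order all_algebra.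
From mathcomp Require Import finmap all_classical all_reals all_analysis.

Set Implicit Arguments.
Unset Strict Implicit.
Unset Printing Implicit Defensive.
Import Order.TTheory GRing.Theory Num.Theory.
Import numFieldNormedType.Exports.
Local Open Scope classical_set_scope.
Local Open Scope ring_scope.

Fixpoint nary (S : Type) (C : S -> Type) (l : seq S) (A : Type) : Type :=
  if l is s :: l' then C s -> nary C l' A else A.

Fixpoint args (S : Type) (C : S -> Type) (l : seq S) : Type :=
  if l is s :: l' then (C s * args C l')%type else unit.

Fixpoint napply (S : Type) (C : S -> Type) (l : seq S) (A : Type) :
    nary C l A -> args C l -> A :=
  match l with
  | [::] => fun f _ => f
  | s :: l' => fun f a => napply (f a.1) a.2
  end.

Fixpoint args_all (S : Type) (C : S -> Type) (P : forall s, C s -> Prop)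
    (l : seq S) : args C l -> Prop :=
  match l with
  | [::] => fun _ => True
  | s :: l' => fun a => P s a.1 /\ args_all P a.2
  end.

Fixpoint args_all2 (S : Type) (C : S -> Type) (P : forall s, C s -> C s -> Prop)
    (l : seq S) : args C l -> args C l -> Prop :=
  match l with
  | [::] => fun _ _ => True
  | s :: l' => fun a b => P s a.1 b.1 /\ args_all2 P a.2 b.2
  end.

(* The metrics are function symbols of every language; they are provided by
   the term constructor [TDist] below, not by [fsym]. *)
Record language := Language {
  lsort : Type;
  rsort : lsort;
  csym : Type;
  csort : csym -> lsort;
  fsym : Type;
  fdom : fsym -> seq lsort;
  fcod : fsym -> lsort }.

(* The isometric bijection [toR] is the identification of the real sort
   with [R]. *)
Record prestructure (R : realType) (L : language) := Prestructure {
  carrier :> lsort L -> metricType R;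
  anchor : forall s, carrier s;
  icst : forall c : csym L, carrier (csort c);
  ifun : forall f : fsym L,
    nary (fun s => carrier s : Type) (fdom f) (carrier (fcod f));
  toR : carrier (rsort L) -> R;
  ofR : R -> carrier (rsort L);
  toRK : cancel toR ofR;
  ofRK : cancel ofR toR;
  toR_dist : forall x y, mdist x y = `|toR x - toR y| }.

(* Every function symbol is bounded and uniformly continuous on bounded sets. *)
Definition henson_structure (R : realType) (L : language)
    (M : prestructure R L) : Prop :=
  forall (f : fsym L) (r : R),
    let in_ball := @args_all _ (fun s => M s : Type)
      (fun s x => mdist (anchor M s) x <= r) (fdom f) in
    let close e := @args_all2 _ (fun s => M s : Type)
      (fun s x y => mdist x y < e) (fdom f) in
    (exists B : R, forall a, in_ball a ->
       mdist (anchor M (fcod f)) (napply (ifun M f) a) <= B) /\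
    (forall e : R, 0 < e -> exists2 e' : R, 0 < e' &
       forall a b, in_ball a -> in_ball b -> close e' a b ->
         mdist (napply (ifun M f) a) (napply (ifun M f) b) < e).

(* Variables are typed de Bruijn indices in a context, i.e. a list of sorts. *)
Inductive var (S : Type) : seq S -> S -> Type :=
| VHere s G : var (s :: G) s
| VThere s s' G : var G s -> var (s' :: G) s.

Inductive term (L : language) (G : seq (lsort L)) : lsort L -> Type :=
| TVar s : var G s -> term G s
| TCst (c : csym L) : term G (csort c)
| TDist s : term G s -> term G s -> term G (rsort L)
| TApp (f : fsym L) : terms G (fdom f) -> term G (fcod f)
with terms (L : language) (G : seq (lsort L)) : seq (lsort L) -> Type :=
| TNil : terms G [::]
| TCons s l : term G s -> terms G l -> terms G (s :: l).

Inductive formula (L : language) (G : seq (lsort L)) : Type :=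
| PBle (t : term G (rsort L)) (q : rat)
| PBge (t : term G (rsort L)) (q : rat)
| PBand (phi psi : formula G)
| PBor (phi psi : formula G)
| PBex (s : lsort L) (q : rat) (q_gt0 : 0 < q) (phi : formula (s :: G))
| PBall (s : lsort L) (q : rat) (q_gt0 : 0 < q) (phi : formula (s :: G)).

(* [approx phi psi]: [psi] is an approximation of [phi]. *)
Inductive approx (L : language) :
    forall G : seq (lsort L), formula G -> formula G -> Prop :=
| ApLe G (t : term G (rsort L)) (q q' : rat) :
    q < q' -> approx (PBle t q) (PBle t q')
| ApGe G (t : term G (rsort L)) (q q' : rat) :
    q' < q -> approx (PBge t q) (PBge t q')
| ApAnd G (phi phi' psi psi' : formula G) :
    approx phi phi' -> approx psi psi' ->
    approx (PBand phi psi) (PBand phi' psi')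
| ApOr G (phi phi' psi psi' : formula G) :
    approx phi phi' -> approx psi psi' ->
    approx (PBor phi psi) (PBor phi' psi')
| ApEx G s (q q' : rat) (q_gt0 : 0 < q) (q'_gt0 : 0 < q')
    (phi phi' : formula (s :: G)) :
    q < q' -> approx phi phi' -> approx (PBex q_gt0 phi) (PBex q'_gt0 phi')
| ApAll G s (q q' : rat) (q_gt0 : 0 < q) (q'_gt0 : 0 < q')
    (phi phi' : formula (s :: G)) :
    q' < q -> approx phi phi' -> approx (PBall q_gt0 phi) (PBall q'_gt0 phi').

Section Semantics.
Context (R : realType) (L : language) (M : prestructure R L).

Notation env := (args (fun s => M s : Type)).

Fixpoint var_eval (G : seq (lsort L)) (s : lsort L) (v : var G s) :
    env G -> M s :=
  match v in var G0 s0 return env G0 -> M s0 with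
  | VHere s0 G0 => fun rho => rho.1
  | VThere s0 s' G0 v' => fun rho => var_eval v' rho.2
  end.

Fixpoint term_eval (G : seq (lsort L)) (rho : env G) (s : lsort L)
    (t : term G s) : M s :=
  match t in term _ s0 return M s0 with
  | TVar _ v => var_eval v rho
  | TCst c => icst M c
  | TDist _ t1 t2 => ofR M (mdist (term_eval rho t1) (term_eval rho t2))
  | TApp f ts => napply (ifun M f) (terms_eval rho ts)
  end
with terms_eval (G : seq (lsort L)) (rho : env G) (l : seq (lsort L))
    (ts : terms G l) : env l :=
  match ts in terms _ l0 return env l0 with
  | TNil => tt
  | TCons _ _ t ts' => (term_eval rho t, terms_eval rho ts')
  end.

Fixpoint sat (G : seq (lsort L)) (phi : formula G) : env G -> Prop :=
  match phi with
  | PBle t q => fun rho => toR (term_eval rho t) <= ratr q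
  | PBge t q => fun rho => ratr q <= toR (term_eval rho t)
  | PBand phi1 phi2 => fun rho => sat phi1 rho /\ sat phi2 rho
  | PBor phi1 phi2 => fun rho => sat phi1 rho \/ sat phi2 rho
  | PBex s q _ phi1 => fun rho =>
      exists x : M s, mdist (anchor M s) x <= ratr q /\ sat phi1 (x, rho)
  | PBall s q _ phi1 => fun rho =>
      forall x : M s, mdist (anchor M s) x < ratr q -> sat phi1 (x, rho)
  end.

Definition approx_sat (phi : formula (L := L) [::]) : Prop :=
  forall psi, approx phi psi -> sat psi tt.
End Semantics.

Definition theory (R : realType) (L : language) (K : prestructure R L -> Prop)
    (phi : formula (L := L) [::]) : Prop :=
  forall M, K M -> approx_sat M phi.

Definition model (R : realType) (L : language)
    (Th : formula (L := L) [::] -> Prop) (M : prestructure R L) : Prop :=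
  forall phi, Th phi -> approx_sat M phi.

Inductive xsort := XZ | XZZ.

(* [YR], [YH], [YB], [VM] stand for the reals, the Hilbert space, its bounded
   operators and the measures; [BL (CY x y)] is the sort of bounded functions
   from [x] to [y], and [BL CM] that of bounded functions from Z to measures. *)
Inductive ysort := YR | YH | YB.
Inductive vsort := VY (y : ysort) | VM.
Inductive combo := CY (x : xsort) (y : ysort) | CM.
Inductive bsort := BV (v : vsort) | BL (c : combo).
Inductive psort := PN | PZ | PA | PB (b : bsort).

Definition cdom (c : combo) : xsort := if c is CY x _ then x else XZ.
Definition cval (c : combo) : vsort := if c is CY _ y then VY y else VM.

Notation sV y := (PB (BV (VY y))).
Notation sR := (sV YR).
Notation sH := (sV YH).
Notation sB := (sV YB).
Notation sM := (PB (BV VM)).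
Notation sL x y := (PB (BL (CY x y))).
Notation sLM := (PB (BL CM)).

Definition xargs (x : xsort) : seq psort :=
  if x is XZ then [:: PZ] else [:: PZ; PZ].

Inductive pet_csym :=
| CN (n : nat) | CZ (i : int) | CQ (q : rat) | CZero (b : bsort)
| CId | CEmpty | CFull.

Definition pet_csort (c : pet_csym) : psort :=
  match c with
  | CN _ => PN | CZ _ => PZ | CQ _ => sR | CZero b => PB b
  | CId => sB | CEmpty => PA | CFull => PA
  end.

(* On the real sort, [FAdd], [FScale] and [FNorm] are addition, multiplication
   and absolute value; on real-valued functions, [FPNorm] is the pointwise
   absolute value. *)
Inductive pet_fsym :=
| FRSub | FRMax | FRMin
| FLeq | FMem
| FZAdd | FZOpp
| FUnion | FInter | FCompl
| FAdd (b : bsort) | FScale (b : bsort) | FNorm (b : bsort)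
| FInner | FPInner (x : xsort)
| FPMax (x : xsort) | FPMin (x : xsort)
| FTv | FMMax | FMMin
| FPNorm (c : combo)
| FAdj | FComp | FPAdj (x : xsort) | FPComp (x : xsort)
| FSing | FChi | FDelta | FConst (c : combo)
| FSnd (y : ysort) | FFst (y : ysort)
| FApp | FEval (c : combo) | FPApp (x : xsort)
| FEvalL (y : ysort) | FEvalR (y : ysort)
| FSigma
| FTrans (y : ysort) | FShear (y : ysort) | FSwap (y : ysort)
| FMTrans
| FInt (y : ysort) | FIntM
| FIntL (y : ysort) | FIntR (y : ysort) | FIntD (y : ysort).

Definition pet_fdom (f : pet_fsym) : seq psort :=
  match f with
  | FRSub | FRMax | FRMin => [:: sR; sR]
  | FLeq => [:: PN; PN]
  | FMem => [:: PZ; PA]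
  | FZAdd => [:: PZ; PZ]
  | FZOpp => [:: PZ]
  | FUnion | FInter => [:: PA; PA]
  | FCompl => [:: PA]
  | FAdd b => [:: PB b; PB b]
  | FScale b => [:: sR; PB b]
  | FNorm b => [:: PB b]
  | FInner => [:: sH; sH]
  | FPInner x => [:: sL x YH; sL x YH]
  | FPMax x | FPMin x => [:: sL x YR; sL x YR]
  | FTv => [:: sM]
  | FMMax | FMMin => [:: sM; sM]
  | FPNorm c => [:: PB (BL c)]
  | FAdj => [:: sB]
  | FComp => [:: sB; sB]
  | FPAdj x => [:: sL x YB]
  | FPComp x => [:: sL x YB; sL x YB]
  | FSing => [:: PZ]
  | FChi => [:: PA]
  | FDelta => [:: PZ]
  | FConst c => [:: PB (BV (cval c))]
  | FSnd y | FFst y => [:: sL XZ y]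
  | FApp => [:: sB; sH]
  | FEval c => PB (BL c) :: xargs (cdom c)
  | FPApp x => [:: sL x YB; sL x YH]
  | FEvalL y | FEvalR y => [:: sL XZZ y; PZ]
  | FSigma => [:: PN]
  | FTrans y => [:: sL XZ y]
  | FShear y | FSwap y => [:: sL XZZ y]
  | FMTrans => [:: sM]
  | FInt y => [:: sL XZ y; sM]
  | FIntM => [:: sLM; sM]
  | FIntL y => [:: sM; sL XZZ y]
  | FIntR y => [:: sL XZZ y; sM]
  | FIntD y => [:: sL XZZ y; sLM]
  end.

Definition pet_fcod (f : pet_fsym) : psort :=
  match f with
  | FRSub | FRMax | FRMin => sR
  | FLeq | FMem => sR
  | FZAdd | FZOpp => PZ
  | FUnion | FInter | FCompl => PA
  | FAdd b | FScale b => PB b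
  | FNorm _ => sR
  | FInner => sR
  | FPInner x => sL x YR
  | FPMax x | FPMin x => sL x YR
  | FTv | FMMax | FMMin => sM
  | FPNorm c => sL (cdom c) YR
  | FAdj | FComp => sB
  | FPAdj x | FPComp x => sL x YB
  | FSing => PA
  | FChi => sL XZ YR
  | FDelta => sM
  | FConst c => PB (BL c)
  | FSnd y | FFst y => sL XZZ y
  | FApp => sH
  | FEval c => PB (BV (cval c))
  | FPApp x => sL x YH
  | FEvalL y | FEvalR y => sL XZ y
  | FSigma => sM
  | FTrans y | FShear y | FSwap y => sL XZZ y
  | FMTrans => sLM
  | FInt y => sV y
  | FIntM => sM
  | FIntL y | FIntR y | FIntD y => sL XZ y
  end.

Definition PET_language : language :=
  Language sR pet_csort pet_fdom pet_fcod.

Section Linf.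
Context {R : realType} (T : Type) (V : normedModType R).

Definition bounded_pred : {pred T -> V} := fun f => `[< bounded_fun f >].

Lemma bounded_predP (f : T -> V) :
  reflect (exists M, forall t, `|f t| <= M) (f \in bounded_pred).
Proof.
rewrite unfold_in; apply: (iffP idP) => [/asboolP/pinfty_ex_gt0[M _ fM]|[M fM]].
  by exists M => t; exact: fM.
apply/asboolP; exists M; split; first exact: num_real.
by move=> N MN t _ /=; rewrite (le_trans (fM t))// ltW.
Qed.

Fact bounded_submod_closed : submod_closed bounded_pred.
Proof.
split; first by apply/bounded_predP; exists 0 => t; rewrite normr0.
move=> a f g /bounded_predP[M fM] /bounded_predP[N gN].
apply/bounded_predP; exists (`|a| * M + N) => t.
rewrite (le_trans (ler_normD _ _))// lerD//.
by rewrite normrZ ler_wpM2l.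
Qed.
HB.instance Definition _ :=
  GRing.isSubmodClosed.Build R (T -> V) bounded_pred bounded_submod_closed.

Record linf := Linf { linf_fun :> T -> V; _ : linf_fun \in bounded_pred }.
HB.instance Definition _ := [isSub for linf_fun].
HB.instance Definition _ := [Choice of linf by <:].
HB.instance Definition _ := [SubChoice_isSubLmodule of linf by <:].

Definition linf_norm (f : linf) : R := sup (range (fun t => `|f t|)).

Lemma linf_norm_ub (f : linf) t : `|f t| <= linf_norm f.
Proof.
have /bounded_predP[M fM] := valP f.
apply: ub_le_sup; last by exists t.
by exists M => _ [s _ <-]; exact: fM.
Qed.
Lemma linf_norm_le (f : linf) M : 0 <= M -> (forall t, `|f t| <= M) ->
  linf_norm f <= M.
Proof.
move=> M0 fM; rewrite /linf_norm.
have [->|/set0P S0] := eqVneq (range (fun t => `|f t|)) set0.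
  by rewrite sup0.
by apply: ge_sup => // _ [s _ <-]; exact: fM.
Qed.
Lemma linf_norm_ge0 (f : linf) : 0 <= linf_norm f.
Proof.
rewrite /linf_norm.
have [->|/set0P [_ [t _ _]]] := eqVneq (range (fun t => `|f t|)) set0.
  by rewrite sup0.
exact: le_trans (linf_norm_ub f t).
Qed.
Fact linf_normD f g : linf_norm (f + g) <= linf_norm f + linf_norm g.
Proof.
apply: linf_norm_le => [|t]; first by rewrite addr_ge0// linf_norm_ge0.
by rewrite (le_trans (ler_normD _ _))// lerD// linf_norm_ub.
Qed.
Fact linf_normZ a f : linf_norm (a *: f) = `|a| * linf_norm f.
Proof.
have le b g : linf_norm (b *: g) <= `|b| * linf_norm g.
  apply: linf_norm_le => [|t]; first by rewrite mulr_ge0// linf_norm_ge0.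
  by rewrite [leLHS]normrZ ler_wpM2l// linf_norm_ub.
apply/eqP; rewrite eq_le le /=.
have [->|a0] := eqVneq a 0; first by rewrite normr0 mul0r linf_norm_ge0.
rewrite -[in leLHS](scalerK a0 f) -ler_pdivlMl ?normr_gt0//.
by rewrite (le_trans (le _ _))// normfV.
Qed.
Fact linf_norm_eq0 f : linf_norm f = 0 -> f = 0.
Proof.
move=> f0; apply/val_inj/funext => t; apply/eqP; rewrite -normr_le0 -f0.
exact: linf_norm_ub.
Qed.
HB.instance Definition _ :=
  Lmodule_isNormed.Build R linf linf_normD linf_normZ linf_norm_eq0.
End Linf.

Section Bop.
Context {R : realType} (V : normedModType R).

Definition bop_pred : {pred V -> V} :=
  fun T => `[< linear T /\ exists M, forall x, `|T x| <= M * `|x| >].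

Fact bop_submod_closed : submod_closed bop_pred.
Proof.
split.
  apply/asboolP; split; first by move=> a x y; rewrite /= scaler0 addr0.
  by exists 0 => x; rewrite normr0 mul0r.
move=> a S T /asboolP[lS [M SM]] /asboolP[lT [N TN]].
apply/asboolP; split.
  move=> b x y /=; rewrite !fctE lS lT !scalerDr !scalerA [b * a]mulrC.
  by rewrite addrACA.
exists (`|a| * M + N) => x; rewrite (le_trans (ler_normD _ _))//.
by rewrite [leRHS]mulrDl lerD// normrZ -mulrA ler_wpM2l.
Qed.
HB.instance Definition _ :=
  GRing.isSubmodClosed.Build R (V -> V) bop_pred bop_submod_closed.

Record bop := Bop { bop_fun :> V -> V; _ : bop_fun \in bop_pred }.
HB.instance Definition _ := [isSub for bop_fun].
HB.instance Definition _ := [Choice of bop by <:].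
HB.instance Definition _ := [SubChoice_isSubLmodule of bop by <:].

Definition bop_norm (T : bop) : R :=
  sup [set `|T x| | x in [set x | `|x| <= 1]].

Lemma bop_linear (T : bop) : linear T.
Proof. by have /asboolP[] := valP T. Qed.
HB.instance Definition _ (T : bop) :=
  GRing.isLinear.Build R V V *:%R (bop_fun T) (bop_linear T).

Lemma bop_norm_ub0 (T : bop) x : `|x| <= 1 -> `|T x| <= bop_norm T.
Proof.
move=> x1; have /asboolP[_ [M TM]] := valP T.
apply: ub_le_sup; last by exists x.
exists `|M| => _ [y /= y1 <-]; apply: (le_trans (TM y)).
rewrite (le_trans (ler_norm _))// normrM normr_id.
by rewrite -[leRHS]mulr1 ler_wpM2l.
Qed.
Lemma bop_norm_ge0 (T : bop) : 0 <= bop_norm T.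
Proof. by apply: le_trans (@bop_norm_ub0 T 0 _); rewrite ?normr0. Qed.
Lemma bop_norm_ub (T : bop) x : `|T x| <= bop_norm T * `|x|.
Proof.
have [->|x0] := eqVneq x 0.
  by rewrite linear0 !normr0 mulr0.
rewrite mulrC -ler_pdivrMl ?normr_gt0//.
have -> : `|x|^-1 * `|T x| = `|T (`|x|^-1 *: x)|.
  by rewrite linearZ normrZ normfV normr_id.
by apply: bop_norm_ub0; rewrite normrZ normfV normr_id mulVf ?normr_eq0.
Qed.
Lemma bop_norm_le (T : bop) M : (forall x, `|x| <= 1 -> `|T x| <= M) ->
  bop_norm T <= M.
Proof.
move=> TM; apply: ge_sup; last by move=> _ [x x1 <-]; exact: TM.
by exists `|T 0|; exists 0 => //=; rewrite normr0.
Qed.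
Fact bop_normD S T : bop_norm (S + T) <= bop_norm S + bop_norm T.
Proof.
apply: bop_norm_le => x x1.
by rewrite (le_trans (ler_normD _ _))// lerD// bop_norm_ub0.
Qed.
Fact bop_normZ a T : bop_norm (a *: T) = `|a| * bop_norm T.
Proof.
have le b S : bop_norm (b *: S) <= `|b| * bop_norm S.
  by apply: bop_norm_le => x x1; rewrite [leLHS]normrZ ler_wpM2l// bop_norm_ub0.
apply/eqP; rewrite eq_le le /=.
have [->|a0] := eqVneq a 0; first by rewrite normr0 mul0r bop_norm_ge0.
rewrite -[in leLHS](scalerK a0 T) -ler_pdivlMl ?normr_gt0//.
by rewrite (le_trans (le _ _))// normfV.
Qed.
Fact bop_norm_eq0 T : bop_norm T = 0 -> T = 0.
Proof.
move=> T0; apply/val_inj/funext => x; apply/eqP; rewrite -normr_le0.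
by rewrite (le_trans (bop_norm_ub T x))// T0 mul0r.
Qed.
HB.instance Definition _ :=
  Lmodule_isNormed.Build R bop bop_normD bop_normZ bop_norm_eq0.
End Bop.

Section Meas.
Context {R : realType}.
Implicit Types c : int -> R^o.

Definition meas_pred : {pred int -> R^o} :=
  fun c => `[< summable [set: int] (EFin \o c) >].

Local Notation mass c := (\esum_(i in [set: int]) `|(c i)%:E|)%E.

Lemma massD c c' : (mass (c + c')%R <= mass c + mass c')%E.
Proof.
rewrite -esumD//; apply: le_esum => i _.
by rewrite -EFinD lee_fin ler_normD.
Qed.
Lemma massZ (a : R) c : (mass (a *: c)%R <= `|a|%:E * mass c)%E.
Proof.
apply: ge_ereal_sup => _ [X XT <-].
rewrite (eq_fsbigr (fun i => `|a|%:E * `|(c i)%:E|)%E); last first.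
  by move=> i _ /=; rewrite normrM EFinM.
rewrite -ge0_mule_fsumr//; apply: lee_wpmul2l; first by rewrite lee_fin.
by apply: ereal_sup_ubound; exists X.
Qed.

Fact meas_submod_closed : submod_closed meas_pred.
Proof.
split.
  apply/asboolP; rewrite /summable esum1 ?ltry// => i _ /=.
  by rewrite normr0.
move=> a c c' /asboolP sc /asboolP sc'; apply/asboolP.
apply: (le_lt_trans (massD _ _)); rewrite lte_add_pinfty//.
apply: (le_lt_trans (massZ _ _)); rewrite lte_mul_pinfty//.
Qed.
HB.instance Definition _ :=
  GRing.isSubmodClosed.Build R (int -> R^o) meas_pred meas_submod_closed.

(* A finite signed measure on Z, encoded by its family of weights. *)
Record meas := Meas { meas_fun :> int -> R^o; _ : meas_fun \in meas_pred }.
HB.instance Definition _ := [isSub for meas_fun].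
HB.instance Definition _ := [Choice of meas by <:].
HB.instance Definition _ := [SubChoice_isSubLmodule of meas by <:].

Definition meas_norm (mu : meas) : R := fine (mass mu).

Lemma massE (mu : meas) : mass mu = (meas_norm mu)%:E.
Proof.
have /asboolP := valP mu; rewrite summableE => fmu.
by rewrite /meas_norm fineK.
Qed.
Fact meas_normD mu nu : meas_norm (mu + nu) <= meas_norm mu + meas_norm nu.
Proof. by rewrite -lee_fin EFinD -!massE; exact: massD. Qed.
Fact meas_normZ a mu : meas_norm (a *: mu) = `|a| * meas_norm mu.
Proof.
have le b nu : meas_norm (b *: nu) <= `|b| * meas_norm nu.
  by rewrite -lee_fin EFinM -!massE; exact: massZ.
apply/eqP; rewrite eq_le le /=.
have [->|a0] := eqVneq a 0.
  by rewrite normr0 mul0r -lee_fin -massE; exact: esum_ge0.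
rewrite -[in leLHS](scalerK a0 mu) -ler_pdivlMl ?normr_gt0//.
by rewrite (le_trans (le _ _))// normfV.
Qed.
Fact meas_norm_eq0 mu : meas_norm mu = 0 -> mu = 0.
Proof.
move=> mu0; apply/val_inj/funext => i; apply/eqP.
rewrite -normr_le0 -lee_fin -mu0 -massE.
apply: esum_ge; exists [set i]; last by rewrite fsbig_set1.
by split.
Qed.
HB.instance Definition _ :=
  Lmodule_isNormed.Build R meas meas_normD meas_normZ meas_norm_eq0.
End Meas.
Arguments meas : clear implicits.

Record hilbertSpace (R : realType) := HilbertSpace {
  hilbert_space :> completeNormedModType R;
  inner : {dot hilbert_space for idfun};
  inner_norm : forall x, inner x x = `|x| ^+ 2 }.

Definition discrete_metric (T : choiceType) : Type := T.

Section DiscreteMetric.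
Context {R : realType} (T : choiceType).
Let dist (x y : discrete_metric T) : R := ((x : T) != y)%:R.
Let distxx x : dist x x = 0. Proof. by rewrite /dist eqxx. Qed.
Let dist_eq0 x y : dist x y = 0 -> x = y.
Proof. by rewrite /dist; case: eqP => // _ /eqP; rewrite oner_eq0. Qed.
Let dist_sym x y : dist x y = dist y x.
Proof. by rewrite /dist eq_sym. Qed.
Let dist_triangle y x z : dist x z <= dist x y + dist y z.
Proof.
rewrite /dist; have [->|_] := eqVneq (x : T) y; first by rewrite add0r.
by rewrite -natrD ler_nat (leq_trans (leq_b1 _))// leq_addr.
Qed.
HB.instance Definition _ := Choice.copy (discrete_metric T) T.
HB.instance Definition _ := isMetric.Build R (discrete_metric T)
  distxx dist_eq0 dist_sym dist_triangle.
End DiscreteMetric.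

Definition normed_metric (R : realType) (V : normedModType R) : Type := V.

Section NormedMetric.
Context {R : realType} (V : normedModType R).
Let dist (x y : normed_metric V) : R := `|(x : V) - y|.
Let dist_ge0 x y : 0 <= dist x y. Proof. exact: normr_ge0. Qed.
Let dist_eq0 x y : dist x y = 0 -> x = y.
Proof. by move/normr0_eq0/subr0_eq. Qed.
HB.instance Definition _ := NormedModule.copy (normed_metric V) V.
Let ballE (x : normed_metric V) d : ball x d = [set y | dist x y < d].
Proof. by rewrite -ball_normE. Qed.
HB.instance Definition _ := PseudoMetric_isMetric.Build R (normed_metric V)
  dist_ge0 dist_eq0 ballE.
End NormedMetric.

(* Elements of the spaces above are built with [insubd 0], whose default value
   is never used below: the functions are bounded, linear or summable as
   required. *)
Section Operations.
Context {R : realType}.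

Definition linf_map T (V W : normedModType R) (h : V -> W) (f : linf T V) :
  linf T W := insubd 0 (fun t => h (f t)).

Definition linf_map2 T (V V' W : normedModType R) (h : V -> V' -> W)
  (f : linf T V) (g : linf T V') : linf T W := insubd 0 (fun t => h (f t) (g t)).

Definition meas_delta (i : int) : meas R := insubd 0 (fun j => (j == i)%:R).

Definition meas_sigma (n : nat) : meas R :=
  n.+1%:R^-1 *: \sum_(i < n.+1) meas_delta i.

Definition meas_map2 (h : R -> R -> R) (mu nu : meas R) : meas R :=
  insubd 0 (fun i => h (mu i) (nu i)).

(* The translate of [sum_j c_j delta_j] is [sum_j c_j delta_(j - i)], whose
   weight at [k] is [c_(i + k)]. *)
Definition meas_trans (i : int) (mu : meas R) : meas R :=
  insubd 0 (fun k => mu (i + k)).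

(* An absolutely convergent series when [f] is bounded and [V] complete. *)
Definition integral (V : normedModType R) (f : int -> V) (mu : meas R) : V :=
  limn (fun n => \sum_(k < n.*2.+1)
    mu (k%:Z - n%:Z) *: f (k%:Z - n%:Z)).

Context (H : hilbertSpace R).

Definition bop_comp (S T : bop H) : bop H := insubd 0 (fun x => S (T x)).
Definition bop_id : bop H := insubd 0 (fun x => x).
(* It exists by the Riesz representation theorem, and is unique. *)
Definition adjoint (T : bop H) : bop H :=
  xget 0 [set S : bop H | forall x y, inner H (T x) y = inner H x (S y)].
End Operations.

Section Classical.
Context (R : realType) (H : hilbertSpace R).

Definition points (x : xsort) : Type :=
  if x is XZ then int else (int * int)%type.

Definition yspace (y : ysort) : normedModType R :=
  match y with YR => R^o | YH => H | YB => bop H end.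

Definition vspace (v : vsort) : normedModType R :=
  match v with VY y => yspace y | VM => meas R end.

Definition bspace (b : bsort) : normedModType R :=
  match b with
  | BV v => vspace v
  | BL c => linf (points (cdom c)) (vspace (cval c))
  end.

Definition pet_carrier (s : psort) : metricType R :=
  match s with
  | PN => discrete_metric nat
  | PZ => discrete_metric int
  | PA => discrete_metric (set int)
  | PB b => normed_metric (bspace b)
  end.

Definition pet_anchor (s : psort) : pet_carrier s :=
  match s with
  | PN => 0%N
  | PZ => 0 : int
  | PA => set0 : set int
  | PB b => 0 : bspace b
  end.

Definition pet_icst (c : pet_csym) : pet_carrier (pet_csort c) :=
  match c with
  | CN n => n
  | CZ i => i
  | CQ q => ratr q : R
  | CZero b => 0 : bspace b
  | CId => bop_id H
  | CEmpty => set0 : set int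
  | CFull => setT : set int
  end.

Definition linf_eval (x : xsort) (V : normedModType R) :
    linf (points x) V -> nary (fun s => pet_carrier s : Type) (xargs x) V :=
  match x with
  | XZ => fun f i => f i
  | XZZ => fun f i j => f (i, j)
  end.

Definition pet_ifun (f : pet_fsym) :
    nary (fun s => pet_carrier s : Type) (pet_fdom f)
      (pet_carrier (pet_fcod f)) :=
  match f with
  | FRSub => fun x y : R => x - y
  | FRMax => fun x y : R => Num.max x y
  | FRMin => fun x y : R => Num.min x y
  | FLeq => fun m n : nat => (m <= n)%N%:R : R
  | FMem => fun (i : int) (A : set int) => (i \in A)%:R : R
  | FZAdd => fun i j : int => i + j
  | FZOpp => fun i : int => - i
  | FUnion => fun A B : set int => A `|` B
  | FInter => fun A B : set int => A `&` B
  | FCompl => fun A : set int => ~` A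
  | FAdd b => fun u v : bspace b => u + v
  | FScale b => fun (a : R) (v : bspace b) => a *: v
  | FNorm b => fun v : bspace b => `|v|
  | FInner => fun x y => inner H x y
  | FPInner x => linf_map2 (W := R^o) (fun x y => inner H x y)
  | FPMax x => linf_map2 (W := R^o) (fun a b : R => Num.max a b)
  | FPMin x => linf_map2 (W := R^o) (fun a b : R => Num.min a b)
  | FTv => fun mu => meas_map2 (fun a _ => `|a|) mu mu
  | FMMax => meas_map2 (fun a b => Num.max a b)
  | FMMin => meas_map2 (fun a b => Num.min a b)
  | FPNorm c => linf_map (W := R^o) (fun v => `|v|)
  | FAdj => fun T => adjoint T
  | FComp => fun S T => bop_comp S T
  | FPAdj x => linf_map (fun T => adjoint T)
  | FPComp x => linf_map2 (fun S T => bop_comp S T)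
  | FSing => fun i : int => [set i]
  | FChi => fun A : set int => insubd (0 : linf int R^o) (fun i => (i \in A)%:R)
  | FDelta => fun i => meas_delta i
  | FConst c => fun v => insubd (0 : bspace (BL c)) (fun _ => v)
  | FSnd y => fun f : linf int (yspace y) =>
      insubd (0 : linf (int * int) (yspace y)) (fun wx => f wx.2)
  | FFst y => fun f : linf int (yspace y) =>
      insubd (0 : linf (int * int) (yspace y)) (fun wx => f wx.1)
  | FApp => fun (T : bop H) x => T x
  | FEval c => @linf_eval (cdom c) (vspace (cval c))
  | FPApp x => linf_map2 (fun (T : bop H) x => T x)
  | FEvalL y => fun (F : linf (int * int) (yspace y)) i =>
      insubd (0 : linf int (yspace y)) (fun j => F (i, j))
  | FEvalR y => fun (F : linf (int * int) (yspace y)) j =>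
      insubd (0 : linf int (yspace y)) (fun i => F (i, j))
  | FSigma => fun n => meas_sigma n
  | FTrans y => fun f : linf int (yspace y) =>
      insubd (0 : linf (int * int) (yspace y)) (fun ij => f (ij.1 + ij.2))
  | FShear y => fun F : linf (int * int) (yspace y) =>
      insubd (0 : linf (int * int) (yspace y))
        (fun ij => F (ij.1, ij.1 + ij.2))
  | FSwap y => fun F : linf (int * int) (yspace y) =>
      insubd (0 : linf (int * int) (yspace y)) (fun ij => F (ij.2, ij.1))
  | FMTrans => fun mu => insubd (0 : linf int (meas R)) (fun i => meas_trans i mu)
  | FInt y => fun (f : linf int (yspace y)) mu => integral f mu
  | FIntM => fun (f : linf int (meas R)) mu => integral f mu
  | FIntL y => fun mu (F : linf (int * int) (yspace y)) =>
      insubd (0 : linf int (yspace y))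
        (fun j => integral (fun i => F (i, j)) mu)
  | FIntR y => fun (F : linf (int * int) (yspace y)) mu =>
      insubd (0 : linf int (yspace y))
        (fun i => integral (fun j => F (i, j)) mu)
  | FIntD y => fun (F : linf (int * int) (yspace y)) (mu : linf int (meas R)) =>
      insubd (0 : linf int (yspace y))
        (fun j => integral (fun i => F (i, j)) (mu j))
  end.

Definition classical_PET : prestructure R PET_language :=
  @Prestructure R PET_language pet_carrier pet_anchor pet_icst pet_ifun
    (fun x : R => x) (fun x : R => x) (fun=> erefl) (fun=> erefl)
    (fun _ _ => erefl).
End Classical.

Definition PET_structure (R : realType) (M : prestructure R PET_language) :
    Prop :=
  henson_structure M /\
  model (theory (fun N => exists H : hilbertSpace R, N = classical_PET H)) M.

Section Leibman.
Context (R : realType) (M : prestructure R PET_language).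

Definition opseq (T : M (sL XZ YB)) (i : M PZ) : M sB :=
  ifun M (FEval (CY XZ YB)) T i.

(* T is identified with the function [opseq T], so that the difference
   operators, and their iterates, act on functions of [M PZ]. *)
Definition Delta (i : M PZ) (U : M PZ -> M sB) : M PZ -> M sB :=
  fun j => ifun M FComp (U (ifun M FZAdd i j)) (ifun M FAdj (U j)).

Definition unitary_Leibman (d : nat) (T : M (sL XZ YB)) : Prop :=
  (forall i : M PZ,
     ifun M FComp (ifun M FAdj (opseq T i)) (opseq T i) = icst M CId /\
     ifun M FComp (opseq T i) (ifun M FAdj (opseq T i)) = icst M CId) /\
  (forall (s : d.+1.-tuple (M PZ)) (j : M PZ),
     foldl (fun U i => Delta i U) (opseq T) s j = icst M CId).

Definition AV (n : M PN) (T : M (sL XZ YB)) : M sB :=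
  ifun M (FInt YB) T (ifun M FSigma n).

Definition unit_ball (x : M sH) : Prop :=
  toR (ifun M (FNorm (BV (VY YH))) x) <= 1.
End Leibman.

Record sampling := Sampling {
  sampling_fun :> nat -> {fset nat};
  sampling_neq0 : forall i, sampling_fun i != fset0;
  sampling_ge : forall i j, j \in sampling_fun i -> (i <= j)%N }.

Record metastability_rate (R : realType) := MetastabilityRate {
  rate_fun :> {posnum R} -> sampling -> {fset nat};
  rate_neq0 : forall e eta, rate_fun e eta != fset0 }.

Definition rate_applies (R : realType) (E : metastability_rate R)
    (X : metricType R) (a : nat -> X) : Prop :=
  forall (e : {posnum R}) (eta : sampling),
    exists2 i, i \in E e eta &
      \big[Num.max/0]_(j <- eta i) \big[Num.max/0]_(k <- eta i)
        mdist (a j) (a k) < e%:num.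

(* Main.v *)
(* Let A_n be the averages of a Leibman sequence T of degree d, and A_n^* those
   of the adjoints. Two observations give a finitary induction on d, uniform over
   all real inner product spaces. First, T_j A_n^* y is, for j much smaller than
   n, close to the mean over i <= n of T_j T_(i+j)^* y, and j |-> T_j T_(i+j)^* is
   a Leibman sequence of degree d - 1; so vectors A_n^* y behave metastably on
   windows below n, by the induction hypothesis in a direct sum of copies of the
   space. Second, |r - A_n^* A_n r|^2 <= |r|^2 - |A_n r|^2. Starting from r = x,
   either A_n r is small on a whole window, or A_n^* A_n r is moved from r to the
   structured part at the expense of the energy of r, which happens a bounded
   number of times.

   In a PET structure, the standard part of a unitary Leibman sequence is a
   Leibman sequence of unitaries on the sort of vectors: the finitely many
   identities this needs are universally quantified equations between terms,
   which hold in all classical structures and hence in every model of their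
   theory. *)
Require Import Defs.
From HB Require Import structures.
From mathcomp Require Import all_boot all_order all_algebra.
From mathcomp Require Import finmap all_classical all_reals all_analysis.
From mathcomp Require Import ring lra.
Set Implicit Arguments.
Unset Strict Implicit.
Unset Printing Implicit Defensive.
Import Order.TTheory GRing.Theory Num.Theory.
Import numFieldNormedType.Exports.
Local Open Scope classical_set_scope.
Local Open Scope ring_scope.

(** * Inner product spaces *)

(** The class of spaces over which the induction is uniform. The form [ip] is only positive
    semidefinite, so [nrm] is a seminorm. *)
Record ipSpace (R : realType) := IpSpace {
  ip_space :> lmodType R;
  ip : ip_space -> ip_space -> R;
  ipC : forall x y, ip x y = ip y x;
  ipDl : forall x y z, ip (x + y) z = ip x z + ip y z;
  ipZl : forall a x y, ip (a *: x) y = a * ip x y;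
  ip_ge0 : forall x, 0 <= ip x x }.

Section IpTheory.
Context (R : realType) (W : ipSpace R).
Implicit Types x y z : W.

Lemma ipDr x y z : ip x (y + z) = ip x y + ip x z.
Proof. by rewrite ipC ipDl !(ipC _ x). Qed.

Lemma ipZr a x y : ip x (a *: y) = a * ip x y.
Proof. by rewrite ipC ipZl ipC. Qed.

Lemma ip0l x : ip 0 x = 0.
Proof. by rewrite -(scale0r 0) ipZl mul0r. Qed.

Lemma ip_suml I (r : seq I) (f : I -> W) y :
  ip (\sum_(i <- r) f i) y = \sum_(i <- r) ip (f i) y.
Proof.
by elim/big_rec2: _ => [|i u v _ <-]; rewrite ?ip0l// ipDl.
Qed.

Lemma ip_sumr I (r : seq I) (f : I -> W) y :
  ip y (\sum_(i <- r) f i) = \sum_(i <- r) ip y (f i).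
Proof. by rewrite ipC ip_suml; apply: eq_bigr => i _; rewrite ipC. Qed.

Lemma ip_sqD (t : R) x y :
  ip (x + t *: y) (x + t *: y) = ip x x + 2 * t * ip x y + t ^+ 2 * ip y y.
Proof. by rewrite ipDl !ipDr !ipZl !ipZr (ipC y x); ring. Qed.

Lemma ip_CauchySchwarz x y : ip x y ^+ 2 <= ip x x * ip y y.
Proof.
have q t := ip_ge0 (x + t *: y); have := ip_ge0 y.
rewrite le_eqVlt => /predU1P[y0|y0].
  have [->|b0] := eqVneq (ip x y) 0; first by rewrite -y0 mulr0 expr0n.
  (* When [ip y y = 0] the quadratic is affine in [t], and this [t] would give it the value -1. *)
  have := q (- (ip x x + 1) / (2 * ip x y)).
  rewrite ip_sqD -y0 mulr0 addr0.
  by rewrite [_ * _ * _](_ : _ = - (ip x x + 1)); [lra | field].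
have := q (- ip x y / ip y y); rewrite ip_sqD.
rewrite [_ + _ + _](_ : _ = ip x x - ip x y ^+ 2 / ip y y); last first.
  by field; rewrite gt_eqF.
by rewrite subr_ge0 ler_pdivrMr.
Qed.

Definition nrm x := Num.sqrt (ip x x).

Lemma nrm_ge0 x : 0 <= nrm x. Proof. exact: sqrtr_ge0. Qed.

Lemma nrm_sq x : nrm x ^+ 2 = ip x x.
Proof. by rewrite sqr_sqrtr// ip_ge0. Qed.

Lemma nrm_leP x c : 0 <= c -> (nrm x <= c) = (ip x x <= c ^+ 2).
Proof. by move=> c0; rewrite -nrm_sq ler_sqr// ?nnegrE ?nrm_ge0. Qed.

Lemma nrmZ a x : nrm (a *: x) = `|a| * nrm x.
Proof. by rewrite /nrm ipZl ipZr mulrA -expr2 sqrtrM ?sqr_ge0// sqrtr_sqr. Qed.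

Lemma nrm0 : nrm 0 = 0. Proof. by rewrite /nrm ip0l sqrtr0. Qed.

Lemma nrmN x : nrm (- x) = nrm x.
Proof. by rewrite -scaleN1r nrmZ normrN1 mul1r. Qed.

Lemma nrmD x y : nrm (x + y) <= nrm x + nrm y.
Proof.
rewrite nrm_leP ?addr_ge0 ?nrm_ge0// -[y in leLHS]scale1r ip_sqD.
rewrite sqrrD !nrm_sq expr1n mul1r mulr1 lerD2r lerD2l.
rewrite -[leRHS]mulr_natl ler_pM2l// (le_trans (ler_norm _))//.
rewrite -ler_sqr ?nnegrE ?mulr_ge0 ?nrm_ge0// exprMn !nrm_sq real_normK ?num_real//.
exact: ip_CauchySchwarz.
Qed.

Lemma nrmB x y : nrm (x - y) <= nrm x + nrm y.
Proof. by rewrite -(nrmN y) nrmD. Qed.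

Lemma nrm_sum I (r : seq I) (f : I -> W) :
  nrm (\sum_(i <- r) f i) <= \sum_(i <- r) nrm (f i).
Proof.
elim/big_rec2: _ => [|i u v _ uv]; first by rewrite nrm0.
by rewrite (le_trans (nrmD _ _))// lerD2l.
Qed.

Lemma nrm_mean n (f : 'I_n.+1 -> W) (c : R) :
  (forall i, nrm (f i) <= c) -> nrm (n.+1%:R^-1 *: \sum_i f i) <= c.
Proof.
move=> fc; rewrite nrmZ ger0_norm ?invr_ge0// ler_pdivrMl ?ltr0n//.
rewrite (le_trans (nrm_sum _ _))// (le_trans (ler_sum _ (fun i _ => fc i)))//.
by rewrite sumr_const card_ord mulr_natl.
Qed.

(** Convexity of the squared norm: the mean of [|f i - g|^2] is nonnegative and equals the mean of
    [|f i|^2] minus [|g|^2]. *)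
Lemma ip_mean n (f : 'I_n.+1 -> W) (g := n.+1%:R^-1 *: \sum_i f i) :
  ip g g <= n.+1%:R^-1 * \sum_i ip (f i) (f i).
Proof.
have n0 : (n.+1%:R : R) != 0 by rewrite pnatr_eq0.
have : 0 <= n.+1%:R^-1 * \sum_i ip (f i - g) (f i - g).
  by rewrite mulr_ge0// sumr_ge0// => i _; exact: ip_ge0.
have -> : \sum_i ip (f i - g) (f i - g)
    = \sum_i ip (f i) (f i) - 2 * ip (\sum_i f i) g + n.+1%:R * ip g g.
  have -> : n.+1%:R * ip g g = \sum_(i < n.+1) ip g g.
    by rewrite sumr_const card_ord mulr_natl.
  rewrite ip_suml mulr_sumr -sumrB -big_split /=; apply: eq_bigr => i _.
  by rewrite -scaleN1r ip_sqD; ring.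
have -> : \sum_i f i = n.+1%:R *: g by rewrite scalerA mulfV// scale1r.
rewrite ipZl; move: n0; set N := n.+1%:R; set X := \sum_i _ => n0.
rewrite [_ * _ in leRHS](_ : _ = N^-1 * X - ip g g); last by field.
by rewrite subr_ge0.
Qed.
End IpTheory.

(** * Direct sums and finite powers of inner product spaces *)

Section Spaces.
Context (R : realType).

Section Pair.
Variables W1 W2 : ipSpace R.
Let V := (W1 * W2)%type : lmodType R.
Let ip2 (u v : V) : R := ip u.1 v.1 + ip u.2 v.2.
Fact pair_ipC x y : ip2 x y = ip2 y x.
Proof. by congr (_ + _); exact: ipC. Qed.
Fact pair_ipDl x y z : ip2 (x + y) z = ip2 x z + ip2 y z.
Proof. by rewrite /ip2 !ipDl addrACA. Qed.
Fact pair_ipZl a x y : ip2 (a *: x) y = a * ip2 x y.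
Proof. by rewrite /ip2 !ipZl mulrDr. Qed.
Fact pair_ip_ge0 x : 0 <= ip2 x x.
Proof. by rewrite addr_ge0 ?ip_ge0. Qed.
Definition pair_ip := IpSpace pair_ipC pair_ipDl pair_ipZl pair_ip_ge0.
End Pair.

Section Power.
Variables (W : ipSpace R) (n : nat).
Let V := {ffun 'I_n.+1 -> W} : lmodType R.
(** The factor [1/(n+1)] gives a constant family the norm of its value and makes the mean of the
    coordinates a contraction. *)
Let ipn (f g : V) : R := n.+1%:R^-1 * \sum_i ip (f i) (g i).
Fact mean_ipC x y : ipn x y = ipn y x.
Proof. by rewrite /ipn; under eq_bigr do rewrite ipC. Qed.
Fact mean_ipDl x y z : ipn (x + y) z = ipn x z + ipn y z.
Proof.
rewrite /ipn; under eq_bigr do rewrite ffunE ipDl.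
by rewrite big_split mulrDr.
Qed.
Fact mean_ipZl a x y : ipn (a *: x) y = a * ipn x y.
Proof.
rewrite /ipn; under eq_bigr do rewrite ffunE ipZl.
by rewrite -mulr_sumr mulrCA.
Qed.
Fact mean_ip_ge0 x : 0 <= ipn x x.
Proof. by rewrite mulr_ge0// sumr_ge0// => i _; exact: ip_ge0. Qed.
Definition mean_ip := IpSpace mean_ipC mean_ipDl mean_ipZl mean_ip_ge0.
End Power.
End Spaces.

(** * Averages of Leibman sequences *)

Section UnitarySequences.
Context {R : realType}.
Implicit Types (W : ipSpace R) (k n a b i L M s : nat).

(** The adjoints [S] are carried as data, since an operator on an incomplete space may have no
    adjoint. *)
Record unitary_seq W (T S : int -> W -> W) : Prop := UnitarySeq {
  useq_lin : forall j, linear (T j);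
  useq_lin_adj : forall j, linear (S j);
  useq_adj : forall j x y, ip (T j x) y = ip x (S j y);
  useqK : forall j, cancel (T j) (S j);
  useqVK : forall j, cancel (S j) (T j) }.

(* The Leibman condition shifted by one: degree at most [d] is [leibman d.+1],
   so that the induction starts from the constant sequence [id]. *)
Fixpoint leibman W k (T S : int -> W -> W) : Prop :=
  if k is k'.+1 then
    forall i : int, leibman k' (fun j => T (i + j) \o S j) (fun j => T j \o S (i + j))
  else forall j x, T j x = x.

Definition avg W n (T : int -> W -> W) x : W :=
  n.+1%:R^-1 *: \sum_(j < n.+1) T (j : nat)%:Z x.

Lemma linear_funD (U V : lmodType R) (f : U -> V) : linear f ->
  {morph f : x y / x + y}.
Proof. by move=> lf x y; rewrite -[x]scale1r lf !scale1r. Qed.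

Lemma linear_fun0 (U V : lmodType R) (f : U -> V) : linear f -> f 0 = 0.
Proof. by move=> lf; apply: (addrI (f 0)); rewrite -linear_funD// !addr0. Qed.

Lemma linear_funZ (U V : lmodType R) (f : U -> V) : linear f ->
  forall a : R, {morph f : x / a *: x}.
Proof. by move=> lf a x; rewrite -[a *: x]addr0 lf linear_fun0// addr0. Qed.

Lemma linear_funB (U V : lmodType R) (f : U -> V) : linear f ->
  {morph f : x y / x - y}.
Proof.
by move=> lf x y; rewrite linear_funD// -scaleN1r linear_funZ// scaleN1r.
Qed.

Lemma linear_fun_sum (U V : lmodType R) (f : U -> V) : linear f ->
  forall I (r : seq I) (g : I -> U), f (\sum_(i <- r) g i) = \sum_(i <- r) f (g i).
Proof.
move=> lf I r g; elim/big_rec2: _ => [|i u v _ <-]; first exact: linear_fun0.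
exact: linear_funD.
Qed.

Section OneSequence.
Context W (T S : int -> W -> W).
Hypothesis TS : unitary_seq T S.

Lemma unitary_seqV : unitary_seq S T.
Proof.
split; [exact: useq_lin_adj TS | exact: useq_lin TS | | | ].
- by move=> j x y; rewrite ipC -(useq_adj TS) ipC.
- exact: useqVK TS.
- exact: useqK TS.
Qed.

Lemma useq_nrm j x : nrm (T j x) = nrm x.
Proof. by rewrite /nrm (useq_adj TS) (useqK TS). Qed.

Lemma avg_lin n : linear (avg n T).
Proof.
move=> c x y; rewrite /avg.
under eq_bigr do rewrite (useq_lin TS).
by rewrite big_split -scaler_sumr scalerDr !scalerA mulrC.
Qed.

Lemma avg_nrm n x : nrm (avg n T x) <= nrm x.
Proof. by apply: nrm_mean => j; rewrite useq_nrm. Qed.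

Lemma avg_adj n x y : ip (avg n T x) y = ip x (avg n S y).
Proof.
rewrite /avg ipZl ipZr ip_suml ip_sumr; congr (_ * _).
by apply: eq_bigr => j _; rewrite (useq_adj TS).
Qed.

Lemma unitary_seq_shift (h : int) : unitary_seq (T \o +%R h) (S \o +%R h).
Proof.
by split=> j; [exact: useq_lin TS _ | exact: useq_lin_adj TS _
  | exact: useq_adj TS _ | exact: useqK TS _ | exact: useqVK TS _].
Qed.

End OneSequence.

Lemma unitary_seq_comp W (T S T' S' : int -> W -> W) : 
  unitary_seq T S -> unitary_seq T' S' ->
  unitary_seq (fun j => T j \o S' j) (fun j => T' j \o S j).
Proof.
move=> TS TS'; split=> j.
- by move=> c x y; rewrite /= (useq_lin_adj TS') (useq_lin TS).
- by move=> c x y; rewrite /= (useq_lin_adj TS) (useq_lin TS').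
- by move=> x y; rewrite /= (useq_adj TS) (useq_adj (unitary_seqV TS')).
- by move=> x; rewrite /= (useqK TS) (useqVK TS').
- by move=> x; rewrite /= (useqK TS') (useqVK TS).
Qed.

Lemma leibman_shift W k (T S : int -> W -> W) (h : int) :
  leibman k T S -> leibman k (T \o +%R h) (S \o +%R h).
Proof.
elim: k T S => [|k IHk] T S /= TS; first by move=> j x; exact: TS.
move=> i; have := IHk _ _ (TS i).
congr (leibman k _ _); apply/funext => j /=; first by rewrite addrCA.
by rewrite addrCA.
Qed.

(** [T j \o S (i + j)] is the difference with step [- i], taken at the index [i + j]. *)
Lemma leibman_dual_diff W k (T S : int -> W -> W) (i : int) :
  leibman k.+1 T S ->
  leibman k (fun j => T j \o S (i + j)) (fun j => T (i + j) \o S j).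
Proof.
move=> /(_ (- i))/(leibman_shift i).
congr (leibman k _ _); apply/funext => j /=; first by rewrite addKr.
by rewrite addKr.
Qed.

Lemma leibman_id W k : leibman k (fun _ (x : W) => x) (fun _ (x : W) => x).
Proof. by elim: k => //= k IHk i; exact: IHk. Qed.
End UnitarySequences.

(** * Uniform metastability and reduction to lower degree *)

Section Metastability.
Context {R : realType}.
Implicit Types (W : ipSpace R) (k n a b L M N s : nat).

Definition osc_lt W (T : int -> W -> W) x (i m : nat) (e : R) :=
  forall a b, (i <= a <= m)%N -> (i <= b <= m)%N ->
    nrm (avg a T x - avg b T x) < e.

(** The bound [N] precedes the space, so that the induction can use it in an auxiliary space built
    from the sequence. *)
Definition uniformly_metastable k := forall (e : R) (F : nat -> nat), 0 < e ->
  exists N, forall W (T S : int -> W -> W) (x : W),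
    unitary_seq T S -> leibman k T S -> nrm x <= 1 ->
    exists2 i, (i <= N)%N & osc_lt T x i (F i) e.

Lemma uniformly_metastable0 : uniformly_metastable 0.
Proof.
move=> e F e0; exists 0%N => W T S x _ T1 _; exists 0%N => // a b _ _.
suff avgx n : avg n T x = x by rewrite !avgx subrr nrm0.
rewrite /avg; under eq_bigr do rewrite T1.
by rewrite sumr_const card_ord -[X in _ *: X]scaler_nat scalerA mulVf ?scale1r// pnatr_eq0.
Qed.

(** Apply the hypothesis to [i |-> F (i + M)] and move the index found from [i] to [i + M]: the
    window only shrinks. *)
Lemma uniformly_metastable_ge k (e : R) (F : nat -> nat) M :
  uniformly_metastable k -> 0 < e ->
  exists N, forall W (T S : int -> W -> W) (x : W),
    unitary_seq T S -> leibman k T S -> nrm x <= 1 ->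
    exists2 i, (M <= i <= N)%N & osc_lt T x i (F i) e.
Proof.
move=> Pk e0; have [N NP] := Pk e (fun i => F (i + M)%N) e0.
exists (N + M)%N => W T S x TS lT x1; have [i iN osc] := NP _ _ _ _ TS lT x1.
exists (i + M)%N; first by rewrite leq_addl leq_add2r.
by move=> a b /andP[ia am] /andP[ib bm];
  apply: osc; rewrite ?am ?bm andbT (leq_trans (leq_addr M i)).
Qed.

(* Up to time [L], and up to the error [delta], the averages of [z] under the
   Leibman sequence [T] are linear images of averages under a sequence of lower
   degree acting on another space. *)
Definition lower_degree W (T : int -> W -> W) k L s (delta : R) (z : W) :=
  exists (V : ipSpace R) (T' S' : int -> V -> V) (y : V) (Phi : V -> W),
    [/\ unitary_seq T' S', leibman k T' S', nrm y <= s%:R,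
        linear Phi /\ (forall v, nrm (Phi v) <= s%:R * nrm v) &
        forall a, (a <= L)%N -> nrm (avg a T z - Phi (avg a T' y)) <= delta].

Lemma lower_degree0 W (T S : int -> W -> W) k L :
  unitary_seq T S -> lower_degree T k L 0 0 0.
Proof.
move=> TS; exists W, (fun=> id), (fun=> id), 0, (fun=> 0); split.
- by split.
- exact: leibman_id.
- by rewrite nrm0.
- by split=> [c x y|v]; rewrite ?scaler0 ?addr0// nrm0 mul0r.
- by move=> a _; rewrite subr0 (linear_fun0 (avg_lin TS a)) nrm0.
Qed.

Lemma nrm_fst (V1 V2 : ipSpace R) (v : pair_ip V1 V2) : nrm v.1 <= nrm v.
Proof. by rewrite /nrm ler_wsqrtr// lerDl ip_ge0. Qed.

Lemma nrm_snd (V1 V2 : ipSpace R) (v : pair_ip V1 V2) : nrm v.2 <= nrm v.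
Proof. by rewrite /nrm ler_wsqrtr// lerDr ip_ge0. Qed.

Lemma nrm_pair (V1 V2 : ipSpace R) (v : pair_ip V1 V2) :
  nrm v <= nrm v.1 + nrm v.2.
Proof.
rewrite nrm_leP ?addr_ge0 ?nrm_ge0// sqrrD !nrm_sq /= addrAC lerDl.
by rewrite mulrn_wge0// mulr_ge0 ?nrm_ge0.
Qed.

Definition pair_map (V1 V2 : ipSpace R) (f : V1 -> V1) (g : V2 -> V2)
  (v : pair_ip V1 V2) : pair_ip V1 V2 := (f v.1, g v.2).

Lemma unitary_seq_pair (V1 V2 : ipSpace R) (T1 S1 : int -> V1 -> V1)
    (T2 S2 : int -> V2 -> V2) : unitary_seq T1 S1 -> unitary_seq T2 S2 ->
  unitary_seq (fun j => pair_map (T1 j) (T2 j)) (fun j => pair_map (S1 j) (S2 j)).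
Proof.
move=> TS1 TS2; split=> j.
- by move=> c x y; rewrite /pair_map (useq_lin TS1) (useq_lin TS2).
- by move=> c x y; rewrite /pair_map (useq_lin_adj TS1) (useq_lin_adj TS2).
- by move=> x y; rewrite /= (useq_adj TS1) (useq_adj TS2).
- by case=> u v; rewrite /pair_map /= (useqK TS1) (useqK TS2).
- by case=> u v; rewrite /pair_map /= (useqVK TS1) (useqVK TS2).
Qed.

Lemma leibman_pair (V1 V2 : ipSpace R) k (T1 S1 : int -> V1 -> V1)
    (T2 S2 : int -> V2 -> V2) : leibman k T1 S1 -> leibman k T2 S2 ->
  leibman k (fun j => pair_map (T1 j) (T2 j)) (fun j => pair_map (S1 j) (S2 j)).
Proof.
elim: k T1 S1 T2 S2 => [|k IHk] T1 S1 T2 S2 l1 l2 /=.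
  by move=> j [u v]; rewrite /pair_map /= l1 l2.
by move=> i; exact: (IHk _ _ _ _ (l1 i) (l2 i)).
Qed.

Lemma avg_pair (V1 V2 : ipSpace R) (T1 : int -> V1 -> V1) (T2 : int -> V2 -> V2)
    a (y1 : V1) (y2 : V2) :
  avg a (fun j => pair_map (T1 j) (T2 j)) (y1, y2) = (avg a T1 y1, avg a T2 y2).
Proof.
rewrite /avg; congr pair => /=; congr (_ *: _).
  by rewrite (raddf_sum fst).
by rewrite (raddf_sum snd).
Qed.

(** The two auxiliary sequences act side by side on the direct sum, so bounds and errors add. *)
Lemma lower_degreeD W (T S : int -> W -> W) k L s1 s2 (d1 d2 : R) z1 z2 :
  unitary_seq T S ->
  lower_degree T k L s1 d1 z1 -> lower_degree T k L s2 d2 z2 ->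
  lower_degree T k L (s1 + s2) (d1 + d2) (z1 + z2).
Proof.
move=> TS [V1 [T1 [S1 [y1 [Phi1 [TS1 l1 ys1 [lin1 b1] ap1]]]]]].
move=> [V2 [T2 [S2 [y2 [Phi2 [TS2 l2 ys2 [lin2 b2] ap2]]]]]].
exists (pair_ip V1 V2), (fun j => pair_map (T1 j) (T2 j)),
  (fun j => pair_map (S1 j) (S2 j)), (y1, y2), (fun v => Phi1 v.1 + Phi2 v.2).
split.
- exact: unitary_seq_pair.
- exact: leibman_pair.
- by rewrite (le_trans (nrm_pair _))// natrD lerD.
- split=> [c u v|v]; first by rewrite /= lin1 lin2 scalerDr addrACA.
  rewrite (le_trans (nrmD _ _))// natrD mulrDl lerD//.
    by rewrite (le_trans (b1 _))// ler_wpM2l// nrm_fst.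
  by rewrite (le_trans (b2 _))// ler_wpM2l// nrm_snd.
- move=> a aL; rewrite avg_pair (linear_funD (avg_lin TS a)) opprD addrACA.
  by rewrite (le_trans (nrmD _ _))// lerD ?ap1 ?ap2.
Qed.

(** Shifting the range of summation by one exchanges two end terms, each of norm [nrm y]; this is
    done [j] times. *)
Lemma nrm_shift_sum W (S T : int -> W -> W) n j y : unitary_seq S T ->
  nrm (\sum_(i < n.+1) S i%:Z y - \sum_(i < n.+1) S (i%:Z + j%:Z) y)
    <= (2 * j)%:R * nrm y.
Proof.
move=> ST; elim: j => [|j IHj].
  by under [X in _ - X]eq_bigr do rewrite addr0; rewrite subrr nrm0 muln0 mul0r.
rewrite -[X in nrm (X - _)](subrK (\sum_(i < n.+1) S (i%:Z + j%:Z) y)) -addrA.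
rewrite (le_trans (nrmD _ _))// mulnSr natrD mulrDl lerD// -sumrB.
pose g (i : nat) := S (i%:Z + j%:Z) y.
rewrite (eq_bigr (fun i : 'I_n.+1 => - (g i.+1 - g i))) => [|i _]; last first.
  by rewrite opprB /g -!PoszD addnS addSn.
rewrite sumrN -(big_mkord xpredT (fun i => g i.+1 - g i)) telescope_sumr// nrmN.
by rewrite (le_trans (nrmB _ _))// !(useq_nrm ST) -mulr2n mulr_natl.
Qed.

Section MeanSpace.
Context W (n : nat).

Definition mean_map (f : 'I_n.+1 -> W -> W) (v : mean_ip W n) : mean_ip W n :=
  [ffun i => f i (v i)].

Lemma unitary_seq_mean (T S : 'I_n.+1 -> int -> W -> W) :
  (forall i : 'I_n.+1, unitary_seq (T i) (S i)) ->
  unitary_seq (fun j => mean_map (T^~ j)) (fun j => mean_map (S^~ j)).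
Proof.
move=> TS; split=> j.
- move=> c x y; apply/ffunP => i; rewrite !ffunE.
  exact: useq_lin (TS i) _ _ _ _.
- move=> c x y; apply/ffunP => i; rewrite !ffunE.
  exact: useq_lin_adj (TS i) _ _ _ _.
- move=> x y; rewrite /=; congr (_^-1 * _); apply: eq_bigr => i _.
  by rewrite !ffunE (useq_adj (TS i)).
- by move=> x; apply/ffunP => i; rewrite !ffunE (useqK (TS i)).
- by move=> x; apply/ffunP => i; rewrite !ffunE (useqVK (TS i)).
Qed.

Lemma leibman_mean k (T S : 'I_n.+1 -> int -> W -> W) :
  (forall i : 'I_n.+1, leibman k (T i) (S i)) ->
  leibman k (fun j => mean_map (T^~ j)) (fun j => mean_map (S^~ j)).
Proof.
elim: k T S => [|k IHk] T S /= TS.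
  by move=> j x; apply/ffunP => i; rewrite ffunE TS.
move=> h.
have := IHk (fun i j => T i (h + j) \o S i j) (fun i j => T i j \o S i (h + j)).
move=> /(_ (fun i => TS i h)); congr (leibman k _ _);
  by apply/funext => j; apply/funext => v; apply/ffunP => i /=; rewrite !ffunE.
Qed.

Lemma avg_mean (T : 'I_n.+1 -> int -> W -> W) a (v : mean_ip W n) (i : 'I_n.+1) :
  avg a (fun j => mean_map (T^~ j)) v i = avg a (T i) (v i).
Proof.
rewrite /avg ffunE; congr (_ *: _).
by rewrite sum_ffunE; apply: eq_bigr => j _; rewrite ffunE.
Qed.

Lemma nrm_mean_map (v : mean_ip W n) : nrm (n.+1%:R^-1 *: \sum_i v i) <= nrm v.
Proof. by rewrite /nrm ler_wsqrtr// ip_mean. Qed.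

End MeanSpace.

(* [avg a T (avg n S y)] is the mean of [T_j S_i y] over [j <= a] and [i <= n];
   for [n] much larger than [a], replacing [i] by [i + j] hardly changes it, and
   [j |-> T_j S_(i+j)] has lower degree. *)
Lemma lower_degree_avg_adj W (T S : int -> W -> W) k L n y :
  unitary_seq T S -> leibman k.+1 T S -> nrm y <= 1 ->
  lower_degree T k L 1 (2 * L%:R / n.+1%:R) (avg n S y).
Proof.
move=> TS lT y1; have ST := unitary_seqV TS.
(* One sequence of lower degree for each [i <= n]; together they act coordinatewise on the constant
   family [y]. *)
pose T' (i : 'I_n.+1) (j : int) := T j \o S (i%:Z + j).
pose S' (i : 'I_n.+1) (j : int) := T (i%:Z + j) \o S j.
exists (mean_ip W n), (fun j => mean_map (T'^~ j)), (fun j => mean_map (S'^~ j)),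
  ([ffun=> y] : mean_ip W n), (fun v : mean_ip W n => n.+1%:R^-1 *: \sum_i v i).
split.
- apply: unitary_seq_mean => i.
  exact: (unitary_seq_comp TS (unitary_seq_shift TS i%:Z)).
- by apply: leibman_mean => i; exact: leibman_dual_diff.
- rewrite /nrm /=; under eq_bigr do rewrite ffunE.
  rewrite sumr_const card_ord -[X in _ * X]mulr_natl mulrA mulVf ?pnatr_eq0//.
  by rewrite mul1r.
- split=> [c u v|v]; last by rewrite mul1r nrm_mean_map.
  under eq_bigr do rewrite !ffunE.
  by rewrite big_split -scaler_sumr scalerDr !scalerA mulrC.
move=> a aL; under eq_bigr do rewrite avg_mean ffunE.
(* Exchanging the two means leaves, under each [T j], the mean of [S (i + j) y], to be compared with
   [avg n S y]. *)
have -> : n.+1%:R^-1 *: \sum_(i < n.+1) avg a (T' i) y =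
    a.+1%:R^-1 *: \sum_(j < a.+1) T j%:Z
      (n.+1%:R^-1 *: \sum_(i < n.+1) S (i%:Z + j%:Z) y).
  rewrite /avg -scaler_sumr scalerA mulrC -scalerA; congr (_ *: _).
  rewrite exchange_big scaler_sumr; apply: eq_bigr => j _.
  by rewrite (linear_funZ (useq_lin TS _)) (linear_fun_sum (useq_lin TS _)).
rewrite /(avg a) -scalerBr -sumrB; apply: nrm_mean => j.
rewrite -(linear_funB (useq_lin TS _)) (useq_nrm TS) -scalerBr nrmZ.
rewrite ger0_norm ?invr_ge0// mulrC ler_wpM2r ?invr_ge0//.
rewrite (le_trans (nrm_shift_sum _ _ _ ST))// natrM -mulrA ler_wpM2l//.
rewrite -[leRHS]mulr1 ler_pM ?nrm_ge0// ler_nat.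
by rewrite (leq_trans _ aL)// -ltnS.
Qed.
End Metastability.

(** * The energy increment argument *)

Section Increment.
Context {R : realType}.
Implicit Types (W : ipSpace R) (k n a b K L M N s m : nat).

(** The structured parts built by the recursion. The lower bound [M] on the scales keeps the error
    per summand below [2 L / (M + 1)]. *)
Inductive adj_sum W (S : int -> W -> W) M : nat -> W -> Prop :=
| AdjSum0 : adj_sum S M 0 0
| AdjSumS s n y z : (M <= n)%N -> nrm y <= 1 -> adj_sum S M s z ->
    adj_sum S M s.+1 (avg n S y + z).

Lemma adj_sum_le W (S : int -> W -> W) M M' s z :
  (M <= M')%N -> adj_sum S M' s z -> adj_sum S M s z.
Proof.
move=> MM'; elim=> [|{}s n y {}z M'n y1 _ IH]; first exact: AdjSum0.
by apply: AdjSumS => //; exact: leq_trans M'n.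
Qed.

Lemma lower_degree_le W (T : int -> W -> W) k L s (d d' : R) z :
  d <= d' -> lower_degree T k L s d z -> lower_degree T k L s d' z.
Proof.
move=> dd' [V [T' [S' [y [Phi [TS l ys lin ap]]]]]].
exists V, T', S', y, Phi; split => // a aL.
by rewrite (le_trans (ap a aL)).
Qed.

Lemma lower_degree_adj_sum W (T S : int -> W -> W) k L M s z :
  unitary_seq T S -> leibman k.+1 T S -> adj_sum S M s z ->
  lower_degree T k L s (s%:R * (2 * L%:R / M.+1%:R)) z.
Proof.
move=> TS lT; elim=> [|{}s n y {}z Mn y1 _ IH].
  by rewrite mul0r; exact: lower_degree0 TS.
rewrite -add1n natrD mulrDl mul1r; apply: (lower_degreeD TS _ IH).
apply: (@lower_degree_le _ _ _ _ _ (2 * L%:R / n.+1%:R)).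
  by rewrite ler_wpM2l// lef_pV2 ?posrE// ler_nat ltnS.
exact: lower_degree_avg_adj.
Qed.

(** [N] is fixed before [L], which can then be taken as the maximum of [F] up to [N]. The error
    [2 * d] comes from replacing both averages by images under [Phi], and [c] from the oscillation
    in lower degree. *)
Lemma lower_degree_metastable k K M (c : R) (F : nat -> nat) :
  uniformly_metastable (R := R) k -> 0 < c ->
  exists N, forall W (T S : int -> W -> W) s L (d : R) z, unitary_seq T S ->
    (s <= K)%N -> lower_degree T k L s d z ->
    (forall i, (i <= N)%N -> (F i <= L)%N) ->
    exists2 i, (M <= i <= N)%N & osc_lt T z i (F i) (2 * d + c).
Proof.
move=> Pk c0; have K0 : 0 < K.+1%:R :> R by rewrite ltr0n.
(* [y] is divided by [K + 1] to enter the unit ball; the square absorbs this rescaling and the bound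
   [s <= K + 1] on [Phi]. *)
have [|N NP] := uniformly_metastable_ge (e := c / K.+1%:R ^+ 2) F M Pk.
  by rewrite divr_gt0// exprn_gt0.
exists N => W T S s L d z TS sK [V [T' [S' [y [Phi [TS' l' ys [lin bPhi] ap]]]]]] FL.
have sK1 : s%:R <= K.+1%:R :> R by rewrite ler_nat leqW.
have [|i /andP[Mi iN] osc] := NP _ _ _ (K.+1%:R^-1 *: y) TS' l'.
  by rewrite nrmZ ger0_norm ?invr_ge0// ler_pdivrMl// mulr1 (le_trans ys).
exists i; rewrite ?Mi//= => a b ia ib.
have avgE n : avg n T' y = K.+1%:R *: avg n T' (K.+1%:R^-1 *: y).
  by rewrite (linear_funZ (avg_lin TS' n)) scalerA mulfV ?scale1r// gt_eqF.
have aL : (a <= L)%N by case/andP: ia => _ /leq_trans; apply; exact: FL.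
have bL : (b <= L)%N by case/andP: ib => _ /leq_trans; apply; exact: FL.
have -> : avg a T z - avg b T z = (avg a T z - Phi (avg a T' y))
    - (avg b T z - Phi (avg b T' y)) + Phi (avg a T' y - avg b T' y).
  rewrite (linear_funB lin) opprB addrACA subrK; congr (_ + _).
  by rewrite addrAC subrr sub0r.
rewrite (le_lt_trans (nrmD _ _))// ler_ltD//.
  by rewrite (le_trans (nrmB _ _))// mulrDl mul1r lerD ?ap.
rewrite (le_lt_trans (bPhi _))// !avgE -scalerBr nrmZ (ger0_norm (ltW K0)).
have := osc a b ia ib; rewrite ltr_pdivlMr ?exprn_gt0// mulrC => /le_lt_trans; apply.
by rewrite expr2 -mulrA ler_wpM2r// mulr_ge0// nrm_ge0.
Qed.

(** Expand the square: the inner product of [r] with [avg n S (avg n T r)] is [|avg n T r|^2], and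
    [avg n S] is a contraction. *)
Lemma energy_decrement W (T S : int -> W -> W) n r (r' := r - avg n S (avg n T r)) :
  unitary_seq T S -> ip r' r' <= ip r r - nrm (avg n T r) ^+ 2.
Proof.
move=> TS; rewrite /r' -scaleN1r ip_sqD -(avg_adj TS) -!nrm_sq.
have : nrm (avg n S (avg n T r)) ^+ 2 <= nrm (avg n T r) ^+ 2.
  by rewrite ler_sqr ?nnegrE ?nrm_ge0// (avg_nrm (unitary_seqV TS)).
by lra.
Qed.

(* Downward recursion over the scales: each failure of metastability moves a
   vector [avg n S (avg n T r)], [n >= M], from the remainder [r] to the
   structured part [z], and costs the remainder the energy [c ^+ 2]. *)
Lemma energy_increment k K (c : R) (F : nat -> nat) m :
  uniformly_metastable (R := R) k -> 0 < c -> (m <= K)%N ->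
  exists M N, forall W (T S : int -> W -> W) z r,
    unitary_seq T S -> leibman k.+1 T S -> adj_sum S M (K - m) z ->
    nrm r <= 1 -> ip r r < m%:R * c ^+ 2 ->
    exists2 i, (i <= N)%N & osc_lt T (z + r) i (F i) (5 * c).
Proof.
move=> Pk c0; elim: m => [_|m IHm mK].
  (* For [m = 0] the energy of [r] would be negative. *)
  by exists 0%N, 0%N => W T S z r _ _ _ _; rewrite mul0r ltNge ip_ge0.
have [M [N MN]] := IHm (ltnW mK).
have [N1 N1P] := lower_degree_metastable K M F Pk c0.
(* [L] covers every window that may be returned, and [M1] makes the total error
   [K * (2 * L) / (M1 + 1)] at most [c]. *)
pose L := \max_(i < N1.+1) F i.
pose M1 := Num.truncn (K%:R * (2 * L%:R) / c : R).
exists (maxn M M1), (maxn N N1) => W T S z r TS lT zs r1 rm.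
have zL : lower_degree T k L (K - m.+1) c z.
  apply: lower_degree_le (lower_degree_adj_sum L TS lT (adj_sum_le (leq_maxr M M1) zs)).
  apply: (@le_trans _ _ (K%:R * (2 * L%:R / M1.+1%:R))).
    by rewrite ler_wpM2r ?mulr_ge0 ?invr_ge0// ler_nat leq_subr.
  by rewrite mulrA ler_pdivrMr ?ltr0n// [leRHS]mulrC -ler_pdivrMr// ltW// truncnS_gt.
have [i iN1|i /andP[Mi iN1] osc] := N1P _ _ _ _ _ _ _ TS (leq_subr _ _) zL.
  exact: (leq_bigmax (Ordinal (iN1 : (i < N1.+1)%N))).
have [[n [inF cn]]|small] :=
    pselect (exists n, (i <= n <= F i)%N /\ c <= nrm (avg n T r)).
  (* The scale satisfies [n >= i >= M], so the recursion applies to [w + z] and [r - w], whose sum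
     is still [z + r]. *)
  have e1 := energy_decrement n r TS.
  set w := avg n S _ in e1.
  have -> : z + r = (w + z) + (r - w) by rewrite [w + z]addrC -addrA [r - w]addrC addNKr.
  have [|||j jN oscj] := MN _ _ _ (w + z) (r - w) TS lT.
  - rewrite -subnSK//; apply: AdjSumS.
    + by case/andP: inF => /(leq_trans Mi).
    + by rewrite (le_trans (avg_nrm TS n r)).
    + exact: adj_sum_le (leq_maxl M M1) zs.
  - rewrite nrm_leP// (le_trans e1)// expr1n lerBlDr (@le_trans _ _ 1)//.
      by rewrite -(expr1n R 2) -nrm_leP.
    by rewrite lerDl sqr_ge0.
  - rewrite (le_lt_trans e1)// ltrBlDr (lt_le_trans rm)// mulrSr mulrDl mul1r.
    by rewrite lerD2l ler_sqr// nnegrE ?nrm_ge0 ?ltW.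
  - by exists j; rewrite // leq_max jN.
have lt_c n : (i <= n <= F i)%N -> nrm (avg n T r) < c.
  by move=> inF; rewrite ltNge; apply/negP => cn; apply: small; exists n.
exists i; first by rewrite leq_max iN1 orbT.
move=> a b ia ib; rewrite !(linear_funD (avg_lin TS _)) opprD addrACA.
rewrite (le_lt_trans (nrmD _ _))//.
(* [3 * c] from the structured part [z], and [2 * c] from the two small averages of [r]. *)
have := osc a b ia ib; have := nrmB (avg a T r) (avg b T r).
have := lt_c a ia; have := lt_c b ib.
by lra.
Qed.

Lemma uniformly_metastableS k :
  uniformly_metastable (R := R) k -> uniformly_metastable (R := R) k.+1.
Proof.
move=> Pk e F e0; pose c := e / 5.
have c0 : 0 < c by rewrite divr_gt0.
(* [K * c ^+ 2] exceeds 1, which bounds the energy of [x], so the recursion can start from [z = 0]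
   and [r = x]. *)
pose K := (Num.truncn (c ^- 2)).+1.
have [M [N MN]] := energy_increment F Pk c0 (leqnn K).
exists N => W T S x TS lT x1.
have [|||i iN osc] := MN W T S 0 x TS lT; first 1 last.
- exact: x1.
- apply: (@le_lt_trans _ _ 1); first by rewrite -(expr1n R 2) -nrm_leP.
  by rewrite -ltr_pdivrMr ?exprn_gt0// mul1r truncnS_gt.
- exists i => //; move: osc; rewrite add0r /c.
  by rewrite [5 * _]mulrC divfK ?pnatr_eq0.
- by rewrite subnn; exact: AdjSum0.
Qed.

Theorem leibman_uniformly_metastable k : uniformly_metastable (R := R) k.
Proof.
elim: k => [|k]; [exact: uniformly_metastable0 | exact: uniformly_metastableS].
Qed.
End Increment.

(** * Transfer of universal sentences *)

Section Transfer.
Context {R : realType} {L : language}.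
Implicit Types (M N : prestructure R L) (G : seq (lsort L)).

Notation env M := (args (fun s => M s : Type)).

Lemma sat_approx M G (phi psi : formula G) :
  Defs.approx phi psi -> forall rho : env M G, sat phi rho -> sat psi rho.
Proof.
elim=> {G phi psi} /=.
- by move=> G t q q' qq' rho /le_trans; apply; rewrite ler_rat ltW.
- by move=> G t q q' qq' rho; apply: le_trans; rewrite ler_rat ltW.
- by move=> G p p' r r' _ IHp _ IHr rho [/IHp ? /IHr].
- by move=> G p p' r r' _ IHp _ IHr rho [/IHp|/IHr]; [left|right].
- move=> G s q q' q0 q'0 p p' qq' _ IH rho [x [xq /IH px]]; exists x; split=> //.
  by rewrite (le_trans xq)// ler_rat ltW.
- move=> G s q q' q0 q'0 p p' qq' _ IH rho px x xq; apply/IH/px.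
  by rewrite (lt_le_trans xq)// ler_rat ltW.
Qed.

(** Quantifiers range over balls, so a universal statement becomes a family of sentences indexed by
    a common radius [q]. *)
Fixpoint forall_closure (q : rat) (q0 : 0 < q) G : formula G -> formula (L := L) [::] :=
  match G with
  | [::] => id
  | s :: G' => fun phi => forall_closure q0 (PBall q0 phi)
  end.

Lemma sat_forall_closure M (q : rat) (q0 : 0 < q) G (phi : formula G) :
  sat (forall_closure q0 phi) (tt : env M [::]) <->
  forall rho : env M G,
    args_all (fun s (x : M s) => mdist (anchor M s) x < ratr q) rho -> sat phi rho.
Proof.
elim: G phi => [|s G IHG] phi /=; first by split=> [? []|/(_ tt I)].
split=> [/IHG H [x rho] [xq rhoq]|H]; first exact: H.
by apply/IHG => rho rhoq x xq; exact: (H (x, rho)).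
Qed.

Lemma approx_forall_closure (q q' : rat) (q0 : 0 < q) (q'0 : 0 < q') G
    (phi psi : formula G) : q' < q ->
  Defs.approx phi psi -> Defs.approx (forall_closure q0 phi) (forall_closure q'0 psi).
Proof.
move=> qq'; elim: G phi psi => [|s G IHG] phi psi //= pp.
by apply: IHG; exact: ApAll.
Qed.

Lemma args_bounded M G (rho : env M G) :
  exists n : nat, args_all (fun s (x : M s) => mdist (anchor M s) x < n%:R) rho.
Proof.
have mono H (sig : env M H) (m n : nat) : (m <= n)%N ->
    args_all (fun s (x : M s) => mdist (anchor M s) x < m%:R) sig ->
    args_all (fun s (x : M s) => mdist (anchor M s) x < n%:R) sig.
  move=> mn; elim: H sig => //= s H IH [x sig] [xm sm]; split; last exact: IH.
  by rewrite (lt_le_trans xm)// ler_nat.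
elim: G rho => [|s G IHG]; first by exists 0%N.
case=> x rho; have [n rn] := IHG rho.
pose m := (Num.truncn (mdist (anchor M s) x)).+1.
exists (maxn m n); split; last exact: mono (leq_maxr _ _) rn.
by rewrite (lt_le_trans (truncnS_gt _))// ler_nat leq_maxl.
Qed.

(** Every environment lies in some ball; use the sentence that quantifies over a larger one. *)
Lemma transfer (K : prestructure R L -> Prop) G (phi psi : formula G) :
  (forall N, K N -> forall rho : env N G, sat phi rho) -> Defs.approx phi psi ->
  forall M, model (theory K) M -> forall rho : env M G, sat psi rho.
Proof.
move=> Kphi pp M MK rho; have [n rn] := args_bounded rho.
(* Approximation strictly shrinks the radius of a universal quantifier, here from [n + 2] to
   [n + 1], which is positive even if [n = 0]. *)
have n0 : 0 < n.+1%:R :> rat by rewrite ltr0n.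
have n1 : 0 < n.+2%:R :> rat by rewrite ltr0n.
have /MK : theory K (forall_closure n1 phi).
  move=> N KN chi /sat_approx; apply; apply/sat_forall_closure => sig _.
  exact: Kphi.
have nn : n.+1%:R < n.+2%:R :> rat by rewrite ltr_nat.
move=> /(_ _ (approx_forall_closure n1 n0 nn pp))/sat_forall_closure; apply.
elim: {phi psi pp Kphi} G rho rn => //= s G IHG [x rho] [xn /IHG rn]; split=> //.
by rewrite (lt_le_trans xn)// ratr_nat ler_nat.
Qed.

Lemma small_rat (e : R) : 0 < e -> exists2 q : rat, 0 < q & ratr q < e.
Proof.
move=> /rat_in_itvoo[q]; rewrite in_itv /= => /andP[q0 qe].
by exists q => //; rewrite -(ltr_rat R) rmorph0.
Qed.

(** The approximations, with bound [q - p] for every rational [p > 0], together give back the exact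
    inequality. *)
Lemma transfer_ge (K : prestructure R L -> Prop) G (t : term G (rsort L)) (q : rat) :
  (forall N, K N -> forall rho : env N G, ratr q <= toR (term_eval rho t)) ->
  forall M, model (theory K) M -> forall rho : env M G,
    ratr q <= toR (term_eval rho t).
Proof.
move=> Kt M MK rho; apply/ler_addgt0Pr => e /small_rat[p p0 /ltW pe].
have qp : q - p < q by rewrite ltrBlDr ltrDl.
rewrite -lerBlDr; apply: (@le_trans _ _ (ratr (q - p))).
  by rewrite rmorphB lerB.
exact: (transfer (phi := PBge t q) Kt (ApGe _ qp) MK rho).
Qed.

Lemma transfer_le (K : prestructure R L -> Prop) G (t : term G (rsort L)) (q : rat) :
  (forall N, K N -> forall rho : env N G, toR (term_eval rho t) <= ratr q) ->
  forall M, model (theory K) M -> forall rho : env M G,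
    toR (term_eval rho t) <= ratr q.
Proof.
move=> Kt M MK rho; apply/ler_addgt0Pr => e /small_rat[p p0 /ltW pe].
have qp : q < q + p by rewrite ltrDl.
apply: (@le_trans _ _ (ratr (q + p))); last by rewrite rmorphD lerD.
exact: (transfer (phi := PBle t q) Kt (ApLe _ qp) MK rho).
Qed.

(** An equation says that a distance is at most 0, and such an inequality transfers exactly. *)
Lemma transfer_eq (K : prestructure R L -> Prop) G s (t u : term G s) :
  (forall N, K N -> forall rho : env N G, term_eval rho t = term_eval rho u) ->
  forall M, model (theory K) M -> forall rho : env M G,
    term_eval rho t = term_eval rho u.
Proof.
move=> Ktu M MK rho; apply: mdist_positivity; apply/eqP; rewrite eq_le mdist_ge0 andbT.
rewrite -(ofRK M (mdist _ _)) -(rmorph0 (@ratr R)).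
apply: (transfer_le (t := TDist t u) _ MK rho) => N KN sig /=.
by rewrite ofRK Ktu// mdistxx rmorph0.
Qed.
End Transfer.

(** * Classical PET structures *)

Section HilbertTheory.
Context {R : realType} (H : hilbertSpace R).
Implicit Types x y z : H.

Lemma innerC x y : inner H x y = inner H y x.
Proof. by rewrite hermC expr0 mul1r. Qed.

Lemma innerDl x y z : inner H (x + y) z = inner H x z + inner H y z.
Proof. by rewrite linearDl. Qed.

Lemma innerZl (a : R) x y : inner H (a *: x) y = a * inner H x y.
Proof. by rewrite linearZl_LR. Qed.

Lemma inner_ge0 x : 0 <= inner H x x.
Proof. by rewrite inner_norm sqr_ge0. Qed.

Definition hilbert_ip : ipSpace R := IpSpace innerC innerDl innerZl inner_ge0.

Lemma inner_CauchySchwarz x y : `|inner H x y| <= `|x| * `|y|.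
Proof.
rewrite -ler_sqr ?nnegrE ?mulr_ge0// exprMn -!inner_norm real_normK ?num_real//.
exact: (@ip_CauchySchwarz R hilbert_ip).
Qed.

(* Riesz: minimize [|v|^2 - 2 f v]; minimizing sequences are Cauchy by the
   parallelogram law. *)
Lemma riesz (f : H -> R) (C : R) : linear (f : H -> R^o) -> (forall x, `|f x| <= C * `|x|) ->
  exists u, forall x, inner H u x = f x.
Proof.
move=> lf fC; pose J (v : H) : R := `|v| ^+ 2 - 2 * f v.
have linD x y : f (x + y) = f x + f y := linear_funD lf x y.
have linZ a x : f (a *: x) = a * f x := linear_funZ lf a x.
have JD v x : J (v + x) = J v + `|x| ^+ 2 + 2 * (inner H v x - f x).
  rewrite /J linD -!inner_norm -[x in LHS]scale1r.
  by have := @ip_sqD R hilbert_ip 1 v x; rewrite /= scale1r => ->; ring.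
have J_lb : has_inf (range J).
  split; first by exists (J 0), 0.
  (* [J v] is at least [|v|^2 - 2 C |v|], that is [(|v| - C)^2 - C^2]. *)
  exists (- C ^+ 2) => _ [v _ <-]; rewrite /J.
  have := fC v; rewrite ler_norml => /andP[_ fv].
  have := sqr_ge0 (`|v| - C); rewrite sqrrB.
  by move: fv; set a : R := `|v|; set b : R := f v; lra.
pose m := inf (range J).
have mJ v : m <= J v by apply: inf_lbound; [case: J_lb | exists v].
have /choice[v vP] : forall n : nat, exists v, J v < m + n.+1%:R^-1.
  move=> n; have n0 : 0 < n.+1%:R^-1 :> R by rewrite invr_gt0.
  by have [_ [v _ <-] vm] := inf_adherent n0 J_lb; exists v.
have v_cauchy n k : `|v n - v k| ^+ 2 <= 2 * n.+1%:R^-1 + 2 * k.+1%:R^-1.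
  have JZ : J (2^-1 *: (v n + v k)) = (J (v n) + J (v k)) / 2 - `|v n - v k| ^+ 2 / 4.
    rewrite /J linZ linD -!inner_norm.
    rewrite -(scaleN1r (v k)) innerZl (innerC (v n + _)) innerZl.
    have := @ip_sqD R hilbert_ip 1 (v n) (v k); rewrite /= scale1r => ->.
    have := @ip_sqD R hilbert_ip (-1) (v n) (v k); rewrite /= => ->.
    by field.
  have := mJ (2^-1 *: (v n + v k)); rewrite JZ.
  have := vP n; have := vP k.
  move: (n.+1%:R^-1) (k.+1%:R^-1) (J (v n)) (J (v k)) (`|v n - v k| ^+ 2).
  by move=> p q b b' a; lra.
have /cvg_ex[/= u vu] : cvgn v.
  apply/cauchy_cvgP/cauchy_exP => e e0.
  have [N] : exists N : nat, 4 / e ^+ 2 < N.+1%:R by eexists; exact: truncnS_gt.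
  rewrite ltr_pdivrMr ?exprn_gt0// mulrC -ltr_pdivrMr ?ltr0n// => Ne.
  exists (v N), N => // n /= Nn; rewrite -ball_normE /=.
  rewrite -ltr_sqr ?nnegrE ?(ltW e0)// (le_lt_trans (v_cauchy N n))//.
  apply: le_lt_trans Ne; have : n.+1%:R^-1 <= N.+1%:R^-1 :> R.
    by rewrite lef_pV2 ?posrE// ler_nat ltnS.
  by move: (n.+1%:R^-1) (N.+1%:R^-1) => p p'; lra.
exists u => x.
(* This says [J u <= J (u + t *: x)]; it is derived up to [e] from a near-minimizer [v n] close to
   [u]. *)
have q t : 0 <= t ^+ 2 * `|x| ^+ 2 + 2 * t * (inner H u x - f x).
  apply/ler_addgt0Pr => e e0.
  pose e' := e / (1 + 2 * `|t| * `|x|).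
  have D0 : 0 < 1 + 2 * `|t| * `|x| by rewrite ltr_wpDr// !mulr_ge0.
  have e'0 : 0 < e' by rewrite divr_gt0.
  have [n [nu ne]] : exists n, `|u - v n| < e' /\ n.+1%:R^-1 < e'.
    have /cvgrPdist_lt/(_ _ e'0) nu := vu.
    near \oo => n; exists n; split; first by near: n.
    by near: n; exact: near_infty_natSinv_lt (PosNum e'0).
  have : m <= J (v n + t *: x) := mJ _.
  rewrite JD (innerC (v n)) innerZl linZ normrZ exprMn real_normK ?num_real//.
  have := vP n.
  have : 2 * t * inner H (v n - u) x <= 2 * `|t| * `|x| * e'.
    rewrite (le_trans (ler_norm _))// !normrM ger0_norm// -!mulrA.
    rewrite ler_wpM2l// ler_wpM2l// (le_trans (inner_CauchySchwarz _ _))//.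
    by rewrite mulrC ler_wpM2l// distrC ltW.
  have -> : e = e' * (1 + 2 * `|t| * `|x|) by rewrite /e' divfK// gt_eqF.
  rewrite innerDl -(scaleN1r u) innerZl (innerC x (v n)); move: ne.
  move: (n.+1%:R^-1) (inner H (v n) x) (inner H u x) (J (v n)) `|t| `|x| (f x) (e').
  by move=> p a b j g h w c; lra.
(* This [t] makes the right-hand side a negative multiple of the square of [inner H u x - f x]; the
   [+ 1] covers [x = 0]. *)
have := q (- (inner H u x - f x) / (`|x| ^+ 2 + 1)).
have x0 := sqr_ge0 `|x|.
set a := inner H u x - f x; move: x0; set p := `|x| ^+ 2 => p0.
rewrite [X in 0 <= X](_ : _ = - (a ^+ 2 * ((p + 2) / (p + 1) ^+ 2))); last first.
  by field; rewrite gt_eqF// ltr_wpDl.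
rewrite oppr_ge0 pmulr_lle0 => [a0|]; last first.
  by rewrite divr_gt0 ?exprn_gt0// ltr_wpDl.
by apply/eqP; rewrite -subr_eq0 -[_ == _]sqrf_eq0 eq_le a0 sqr_ge0.
Unshelve. all: by end_near. Qed.
End HilbertTheory.

(** * Operators on a Hilbert space and their adjoints *)

Section ClassicalOperations.
Context {R : realType} (H : hilbertSpace R).

Lemma bop_compE (S T : bop H) x : bop_comp S T x = S (T x).
Proof.
rewrite /bop_comp [bop_fun _](@insubdK _ _ (bop H))//.
apply/asboolP; split=> [a y z|]; first by rewrite !linearP.
exists (bop_norm S * bop_norm T) => y; rewrite (le_trans (bop_norm_ub _ _))//.
by rewrite -mulrA ler_wpM2l ?bop_norm_ge0 ?bop_norm_ub.
Qed.

Lemma bop_idE x : bop_id H x = x.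
Proof.
rewrite /bop_id [bop_fun _](@insubdK _ _ (bop H))//.
by apply/asboolP; split=> //; exists 1 => y; rewrite mul1r.
Qed.

Lemma inner_inj (x y : H) : (forall z, inner H z x = inner H z y) -> x = y.
Proof.
move=> xy; apply/eqP; rewrite -subr_eq0 -normr_eq0 -sqrf_eq0 -inner_norm.
by rewrite linearBr /= xy subrr.
Qed.

(** Riesz gives the adjoint [S] pointwise. Linearity follows from [inner_inj], and boundedness from
    [|S v|^2 = inner H (T (S v)) v]. *)
Lemma adjointP (T : bop H) x y : inner H (T x) y = inner H x (adjoint T y).
Proof.
have riesz_y z : exists u, forall x, inner H x u = inner H (T x) z.
  have [||u uP] := @riesz _ H (fun x => inner H (T x) z) (bop_norm T * `|z|).
  - by move=> a v w; rewrite linearP innerDl innerZl.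
  - move=> v; rewrite (le_trans (inner_CauchySchwarz _ _))// mulrAC.
    by rewrite ler_wpM2r// bop_norm_ub.
  - by exists u => v; rewrite innerC uP.
have [S SP] := choice riesz_y.
have Sbop : S \in @bop_pred R H.
  apply/asboolP; split=> [a v w|].
    by apply: inner_inj => z; rewrite linearDr linearZr_LR /= !SP linearDr linearZr_LR.
  exists (bop_norm T) => v.
  have [->|Sv0] := eqVneq (S v) 0; first by rewrite normr0 mulr_ge0 ?bop_norm_ge0.
  have Sv : 0 < `|S v| by rewrite normr_gt0.
  rewrite -(ler_pM2l Sv) -expr2 -inner_norm SP (le_trans (ler_norm _))//.
  rewrite (le_trans (inner_CauchySchwarz _ _))// mulrA ler_wpM2r//.
  by rewrite mulrC bop_norm_ub.
(* [S] inhabits the set under [xget], which excludes the default value. *)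
rewrite /adjoint; case: xgetP => [S' _ S'P|]; first exact: S'P.
by move=> /(_ (Bop Sbop)) []; move=> v w; rewrite /= SP.
Qed.
End ClassicalOperations.

(** * Averages as integrals against [meas_sigma] *)

Section ClassicalAverages.
Context {R : realType}.

Lemma meas_deltaE (i j : int) : meas_delta i j = (j == i)%:R :> R.
Proof.
rewrite /meas_delta [meas_fun _](@insubdK _ _ (meas R))//.
apply/asboolP; rewrite /summable.
rewrite (eq_esum (b := fun k => if k \in [set i] then 1%E else 0%E)); last first.
  move=> k _ /=; case: ifPn => [/set_mem ->|]; first by rewrite eqxx normr1.
  rewrite notin_setE => /eqP/negPf ki; by rewrite ki normr0.
by rewrite -esum_mkcond esum_set1// ltry.
Qed.

Lemma meas_sigmaE n (j : int) :
  meas_sigma n j = n.+1%:R^-1 * \sum_(i < n.+1) (j == i%:Z)%:R :> R.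
Proof.
have valD : {morph (fun mu : meas R => mu j : R) : mu nu / mu + nu} by [].
rewrite [LHS](_ : _ = n.+1%:R^-1 * (\sum_(i < n.+1) meas_delta i%:Z : meas R) j)//.
congr (_ * _); rewrite (big_morph (fun mu : meas R => mu j : R) valD erefl).
by apply: eq_bigr => i _; rewrite meas_deltaE.
Qed.

(** [meas_sigma n] lives on [0, ..., n], so the symmetric partial sums are constant from the index
    [n] on. *)
Lemma integral_sigma (V : normedModType R) (f : int -> V) n :
  Defs.integral f (meas_sigma n) = n.+1%:R^-1 *: \sum_(i < n.+1) f i%:Z.
Proof.
have sigmaZ (z : int) : meas_sigma n z *: f z =
    n.+1%:R^-1 *: \sum_(i < n.+1) if z == i%:Z then f i%:Z else 0.
  rewrite meas_sigmaE -scalerA scaler_suml; congr (_ *: _).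
  by apply: eq_bigr => i _; case: eqP => [->|_]; rewrite ?scale1r ?scale0r.
rewrite /Defs.integral; apply: cvg_lim; first exact: norm_hausdorff.
apply: cvg_near_cst; exists n => // m /= nm.
under eq_bigr do rewrite sigmaZ.
rewrite -scaler_sumr exchange_big; congr (_ *: _); apply: eq_bigr => i _ /=.
(* The point [i] has position [i + m] in the window from [- m] to [m]. *)
have im : (i + m < m.*2.+1)%N.
  by rewrite -addnn ltnS leq_add2r (leq_trans _ nm)// -ltnS.
rewrite -big_mkcond (big_pred1 (Ordinal im))// => k /=.
by rewrite subr_eq -PoszD eqz_nat.
Qed.

Lemma bop_sumE (V : normedModType R) I (r : seq I) (f : I -> bop V) (x : V) :
  (\sum_(i <- r) f i) x = \sum_(i <- r) f i x.
Proof.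
have valD : {morph (fun T : bop V => T x) : S T / S + T} by [].
exact: (big_morph (fun T : bop V => T x) valD erefl).
Qed.

(** Together with [integral_sigma0], this determines the averages by recursion, each step being a
    short equation of the language that can be transferred. *)
Lemma integral_sigmaS (V : normedModType R) (f : int -> bop V) n x :
  Defs.integral f (meas_sigma n.+1) x = (n.+1%:R / n.+2%:R) *: Defs.integral f (meas_sigma n) x
    + n.+2%:R^-1 *: f n.+1%:Z x.
Proof.
have avgE m : Defs.integral f (meas_sigma m) x = m.+1%:R^-1 *: \sum_(i < m.+1) f i%:Z x.
  by rewrite integral_sigma -bop_sumE.
rewrite !avgE big_ord_recr scalerDr scalerA; congr (_ *: _ + _).
by rewrite mulrAC mulfV ?mul1r// pnatr_eq0.
Qed.

Lemma integral_sigma0 (V : normedModType R) (f : int -> V) :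
  Defs.integral f (meas_sigma 0) = f 0.
Proof. by rewrite integral_sigma big_ord1 invr1 scale1r. Qed.
End ClassicalAverages.

(** * Abstract PET structures *)

Section AbstractPET.
Context {R : realType} (M : prestructure R PET_language).
Hypothesis MPET : PET_structure M.

Notation ap1 f t := (@TApp PET_language _ f (TCons t (TNil _))).
Notation ap2 f t u := (@TApp PET_language _ f (TCons t (TCons u (TNil _)))).
Notation cst c := (@TCst PET_language _ c).
Notation v0 := (TVar (VHere _ _)).
Notation v1 := (TVar (VThere _ (VHere _ _))).
Notation v2 := (TVar (VThere _ (VThere _ (VHere _ _)))).
Notation pterm := (@term PET_language).

(** The identities in [M] below name two terms and check their equality in the classical
    structures. *)
Lemma pet_eq G s (t u : pterm G s) :
  (forall (H : hilbertSpace R) rho,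
    term_eval (M := classical_PET H) rho t = term_eval (M := classical_PET H) rho u) ->
  forall rho, term_eval (M := M) rho t = term_eval (M := M) rho u.
Proof.
by move=> tu; apply: transfer_eq (proj2 MPET) => _ [H ->]; exact: tu.
Qed.

Definition hadd : M sH -> M sH -> M sH := ifun M (FAdd (BV (VY YH))).
Definition hscale : M sR -> M sH -> M sH := ifun M (FScale (BV (VY YH))).
Definition radd : M sR -> M sR -> M sR := ifun M (FAdd (BV (VY YR))).
Definition rmul : M sR -> M sR -> M sR := ifun M (FScale (BV (VY YR))).
Definition hinner : M sH -> M sH -> M sR := ifun M FInner.
Definition hnorm : M sH -> M sR := ifun M (FNorm (BV (VY YH))).
Definition bapp : M sB -> M sH -> M sH := ifun M FApp.
Definition hzero : M sH := icst M (CZero (BV (VY YH))).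
Definition rcst (q : rat) : M sR := icst M (CQ q).

Notation Fadd := (FAdd (BV (VY YH))).
Notation Fscale := (FScale (BV (VY YH))).

Lemma haddC x y : hadd x y = hadd y x.
Proof.
have E := @pet_eq [:: sH; sH] sH (ap2 Fadd v0 v1) (ap2 Fadd v1 v0).
by apply: (E _ (x, (y, tt))) => H [a [b []]]; exact: addrC.
Qed.

Lemma haddA x y z : hadd x (hadd y z) = hadd (hadd x y) z.
Proof.
have E := @pet_eq [:: sH; sH; sH] sH
  (ap2 Fadd v0 (ap2 Fadd v1 v2)) (ap2 Fadd (ap2 Fadd v0 v1) v2).
by apply: (E _ (x, (y, (z, tt)))) => H [a [b [c []]]]; exact: addrA.
Qed.

Lemma hadd0 x : hadd hzero x = x.
Proof.
have E := @pet_eq [:: sH] sH (ap2 Fadd (cst (CZero (BV (VY YH)))) v0) v0.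
by apply: (E _ (x, tt)) => H [a []]; exact: add0r.
Qed.

Lemma haddN x : hadd (hscale (rcst (-1)) x) x = hzero.
Proof.
have E := @pet_eq [:: sH] sH
  (ap2 Fadd (ap2 Fscale (cst (CQ (-1))) v0) v0) (cst (CZero (BV (VY YH)))).
apply: (E _ (x, tt)) => H [a []] /=.
by rewrite rmorphN1 scaleN1r addNr.
Qed.

Lemma hscaleA r s x : hscale r (hscale s x) = hscale (rmul r s) x.
Proof.
have E := @pet_eq [:: sR; sR; sH] sH
  (ap2 Fscale v0 (ap2 Fscale v1 v2)) (ap2 Fscale (ap2 (FScale (BV (VY YR))) v0 v1) v2).
by apply: (E _ (r, (s, (x, tt)))) => H [a [b [c []]]]; exact: scalerA.
Qed.

Lemma hscale1 x : hscale (rcst 1) x = x.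
Proof.
have E := @pet_eq [:: sH] sH (ap2 Fscale (cst (CQ 1)) v0) v0.
by apply: (E _ (x, tt)) => H [a []] /=; rewrite rmorph1 scale1r.
Qed.

Lemma hscaleDr r x y : hscale r (hadd x y) = hadd (hscale r x) (hscale r y).
Proof.
have E := @pet_eq [:: sR; sH; sH] sH
  (ap2 Fscale v0 (ap2 Fadd v1 v2)) (ap2 Fadd (ap2 Fscale v0 v1) (ap2 Fscale v0 v2)).
by apply: (E _ (r, (x, (y, tt)))) => H [a [b [c []]]]; exact: scalerDr.
Qed.

Lemma hscaleDl r s x : hscale (radd r s) x = hadd (hscale r x) (hscale s x).
Proof.
have E := @pet_eq [:: sR; sR; sH] sH
  (ap2 Fscale (ap2 (FAdd (BV (VY YR))) v0 v1) v2)
  (ap2 Fadd (ap2 Fscale v0 v2) (ap2 Fscale v1 v2)).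
by apply: (E _ (r, (s, (x, tt)))) => H [a [b [c []]]]; exact: scalerDl.
Qed.

Lemma hinnerC x y : hinner x y = hinner y x.
Proof.
have E := @pet_eq [:: sH; sH] sR (ap2 FInner v0 v1) (ap2 FInner v1 v0).
by apply: (E _ (x, (y, tt))) => H [a [b []]]; exact: innerC.
Qed.

Lemma hinnerDl x y z : hinner (hadd x y) z = radd (hinner x z) (hinner y z).
Proof.
have E := @pet_eq [:: sH; sH; sH] sR (ap2 FInner (ap2 Fadd v0 v1) v2)
  (ap2 (FAdd (BV (VY YR))) (ap2 FInner v0 v2) (ap2 FInner v1 v2)).
by apply: (E _ (x, (y, (z, tt)))) => H [a [b [c []]]]; exact: innerDl.
Qed.

Lemma hinnerZl r x y : hinner (hscale r x) y = rmul r (hinner x y).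
Proof.
have E := @pet_eq [:: sR; sH; sH] sR (ap2 FInner (ap2 Fscale v0 v1) v2)
  (ap2 (FScale (BV (VY YR))) v0 (ap2 FInner v1 v2)).
by apply: (E _ (r, (x, (y, tt)))) => H [a [b [c []]]]; exact: innerZl.
Qed.

Lemma hinner_norm x : hinner x x = rmul (hnorm x) (hnorm x).
Proof.
have E := @pet_eq [:: sH] sR (ap2 FInner v0 v0)
  (ap2 (FScale (BV (VY YR))) (ap1 (FNorm (BV (VY YH))) v0) (ap1 (FNorm (BV (VY YH))) v0)).
by apply: (E _ (x, tt)) => H [a []]; exact: inner_norm.
Qed.

Lemma hnorm_ge0 x : 0 <= toR (hnorm x).
Proof.
rewrite -(rmorph0 (@ratr R)).
have E := @transfer_ge R PET_language _ [:: sH] (ap1 (FNorm (BV (VY YH))) v0) 0.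
apply: (E _ _ M (proj2 MPET) (x, tt)) => _ [H ->] [a []] /=.
by rewrite rmorph0.
Qed.

(** Ties the metric of the vector sort, in which the rate is measured, to the norm. *)
Lemma hdist x y : mdist x y = toR (hnorm (hadd x (hscale (rcst (-1)) y))).
Proof.
have E := @pet_eq [:: sH; sH] sR (@TDist PET_language _ _ v0 v1)
  (ap1 (FNorm (BV (VY YH))) (ap2 Fadd v0 (ap2 Fscale (cst (CQ (-1))) v1))).
rewrite -[LHS](ofRK M); congr toR; apply: (E _ (x, (y, tt))) => H [a [b []]] /=.
by rewrite rmorphN1 scaleN1r.
Qed.

Lemma bapp_lin S r x y :
  bapp S (hadd (hscale r x) y) = hadd (hscale r (bapp S x)) (bapp S y).
Proof.
have E := @pet_eq [:: sB; sR; sH; sH] sH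
  (ap2 FApp v0 (ap2 Fadd (ap2 Fscale v1 v2) (TVar (VThere _ (VThere _ (VThere _ (VHere _ _)))))))
  (ap2 Fadd (ap2 Fscale v1 (ap2 FApp v0 v2))
    (ap2 FApp v0 (TVar (VThere _ (VThere _ (VThere _ (VHere _ _))))))).
apply: (E _ (S, (r, (x, (y, tt))))) => H [T [a [b [c []]]]].
exact: bop_linear.
Qed.

Lemma bapp_comp S T x : bapp (ifun M FComp S T) x = bapp S (bapp T x).
Proof.
have E := @pet_eq [:: sB; sB; sH] sH (ap2 FApp (ap2 FComp v0 v1) v2)
  (ap2 FApp v0 (ap2 FApp v1 v2)).
by apply: (E _ (S, (T, (x, tt)))) => H [a [b [c []]]]; exact: bop_compE.
Qed.

Lemma bapp_id x : bapp (icst M CId) x = x.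
Proof.
have E := @pet_eq [:: sH] sH (ap2 FApp (cst CId) v0) v0.
by apply: (E _ (x, tt)) => H [a []]; exact: bop_idE.
Qed.

Lemma bapp_adj S x y : hinner (bapp S x) y = hinner x (bapp (ifun M FAdj S) y).
Proof.
have E := @pet_eq [:: sB; sH; sH] sR (ap2 FInner (ap2 FApp v0 v1) v2)
  (ap2 FInner v1 (ap2 FApp (ap1 FAdj v0) v2)).
by apply: (E _ (S, (x, (y, tt)))) => H [a [b [c []]]]; exact: adjointP.
Qed.

(** The adjoint of [S T^*] acts as [T S^*], so the adjoints of a difference form the second family
    in [leibman]. *)
Lemma bapp_adj_comp S T x :
  bapp (ifun M FAdj (ifun M FComp S (ifun M FAdj T))) x = bapp T (bapp (ifun M FAdj S) x).
Proof.
have E := @pet_eq [:: sB; sB; sH] sH (ap2 FApp (ap1 FAdj (ap2 FComp v0 (ap1 FAdj v1))) v2)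
  (ap2 FApp v1 (ap2 FApp (ap1 FAdj v0) v2)).
apply: (E _ (S, (T, (x, tt)))) => H [a [b [c []]]] /=.
apply: inner_inj => z; rewrite -adjointP bop_compE adjointP.
by rewrite innerC -adjointP innerC.
Qed.

Lemma zadd_cst (i j : int) :
  ifun M FZAdd (icst M (CZ i)) (icst M (CZ j)) = icst M (CZ (i + j)).
Proof.
have E := @pet_eq [::] PZ (ap2 FZAdd (cst (CZ i)) (cst (CZ j))) (cst (CZ (i + j))).
by apply: (E _ tt) => H [].
Qed.

Lemma AV0 (T : M (sL XZ YB)) x :
  bapp (AV (icst M (CN 0)) T) x = bapp (opseq T (icst M (CZ 0))) x.
Proof.
have E := @pet_eq [:: sL XZ YB; sH] sH
  (ap2 FApp (ap2 (FInt YB) v0 (ap1 FSigma (cst (CN 0)))) v1)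
  (ap2 FApp (ap2 (FEval (CY XZ YB)) v0 (cst (CZ 0))) v1).
apply: (E _ (T, (x, tt))) => H [f [a []]] /=.
by congr (bop_fun _ a); exact: integral_sigma0.
Qed.

Lemma AVS (T : M (sL XZ YB)) n x :
  bapp (AV (icst M (CN n.+1)) T) x =
  hadd (hscale (rcst (n.+1%:R / n.+2%:R)) (bapp (AV (icst M (CN n)) T) x))
    (hscale (rcst n.+2%:R^-1) (bapp (opseq T (icst M (CZ n.+1))) x)).
Proof.
have E := @pet_eq [:: sL XZ YB; sH] sH
  (ap2 FApp (ap2 (FInt YB) v0 (ap1 FSigma (cst (CN n.+1)))) v1)
  (ap2 Fadd (ap2 Fscale (cst (CQ (n.+1%:R / n.+2%:R)))
      (ap2 FApp (ap2 (FInt YB) v0 (ap1 FSigma (cst (CN n)))) v1))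
    (ap2 Fscale (cst (CQ n.+2%:R^-1))
      (ap2 FApp (ap2 (FEval (CY XZ YB)) v0 (cst (CZ n.+1))) v1))).
apply: (E _ (T, (x, tt))) => H [f [a []]] /=.
rewrite rmorphM !fmorphV !rmorph_nat; exact: integral_sigmaS.
Qed.

Lemma rcstE q : toR (rcst q) = ratr q.
Proof.
apply/eqP; rewrite eq_le; apply/andP; split.
  have E := @transfer_le R PET_language _ [::] (cst (CQ q)) q.
  by apply: (E _ _ M (proj2 MPET) tt) => _ [H ->] [].
have E := @transfer_ge R PET_language _ [::] (cst (CQ q)) q.
by apply: (E _ _ M (proj2 MPET) tt) => _ [H ->] [].
Qed.

Lemma radd_cst p q : radd (rcst p) (rcst q) = rcst (p + q).
Proof.
have E := @pet_eq [::] sR (ap2 (FAdd (BV (VY YR))) (cst (CQ p)) (cst (CQ q)))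
  (cst (CQ (p + q))).
by apply: (E _ tt) => H [] /=; rewrite rmorphD.
Qed.

Lemma rmul_cst p q : rmul (rcst p) (rcst q) = rcst (p * q).
Proof.
have E := @pet_eq [::] sR (ap2 (FScale (BV (VY YR))) (cst (CQ p)) (cst (CQ q)))
  (cst (CQ (p * q))).
by apply: (E _ tt) => H [] /=; rewrite rmorphM.
Qed.

Lemma rcst_dense (x : M sR) (d : R) : 0 < d -> exists q, mdist x (rcst q) < d.
Proof.
move=> d0; have /rat_in_itvoo[q] : toR x < toR x + d by rewrite ltrDl.
rewrite in_itv /= => /andP[xq qx]; exists q; rewrite toR_dist rcstE distrC.
by rewrite gtr0_norm ?subr_gt0// ltrBlDl.
Qed.

(** The identification [toR] is given only as an isometric bijection. Agreement of [f] and [h] on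
    rational constants extends by density, as [f] is uniformly continuous on balls and [h] is
    continuous. *)
Lemma real_op_ext (f : M sR -> M sR -> M sR) (h : R -> R -> R) (h' : rat -> rat -> rat) :
  (forall r e : R, 0 < e -> exists2 d : R, 0 < d & forall x y x' y',
    mdist (anchor M sR) x <= r -> mdist (anchor M sR) y <= r ->
    mdist (anchor M sR) x' <= r -> mdist (anchor M sR) y' <= r ->
    mdist x x' < d -> mdist y y' < d -> mdist (f x y) (f x' y') < e) ->
  (forall x y e : R, 0 < e -> exists2 d : R, 0 < d & forall x' y',
    `|x - x'| < d -> `|y - y'| < d -> `|h x y - h x' y'| < e) ->
  (forall p q, f (rcst p) (rcst q) = rcst (h' p q)) ->
  (forall p q, ratr (h' p q) = h (ratr p) (ratr q)) ->
  forall x y, toR (f x y) = h (toR x) (toR y).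
Proof.
move=> fu hc fh hh x y; apply/eqP; rewrite -subr_eq0 -normr_le0.
apply/ler_addgt0Pr => e e0; rewrite add0r.
have e2 : 0 < e / 2 by rewrite divr_gt0.
(* This ball contains [x], [y] and their rational approximations, taken at distance below 1. *)
pose r := mdist (anchor M sR) x + mdist (anchor M sR) y + 1.
have [d1 d10 D1] := fu r _ e2; have [d2 d20 D2] := hc (toR x) (toR y) _ e2.
pose d := Num.min 1 (Num.min d1 d2).
have d0 : 0 < d by rewrite !lt_min ltr01 d10.
have [p] := rcst_dense x d0; have [q] := rcst_dense y d0.
rewrite !lt_min => /and3P[yq1 yqd1 yqd2] /and3P[xp1 xpd1 xpd2].
have := mdist_ge0 (anchor M sR) x; have := mdist_ge0 (anchor M sR) y => y0 x0.
have tp := metric_triangle (anchor M sR) x (rcst p).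
have tq := metric_triangle (anchor M sR) y (rcst q).
have fd : mdist (f x y) (f (rcst p) (rcst q)) < e / 2.
  by apply: D1 => //; rewrite /r; lra.
have hd : `|h (toR x) (toR y) - h (ratr p) (ratr q)| < e / 2.
  by apply: D2; rewrite -rcstE -toR_dist.
rewrite toR_dist fh rcstE hh in fd; apply: ltW.
rewrite (_ : _ - _ = (toR (f x y) - h (ratr p) (ratr q))
  - (h (toR x) (toR y) - h (ratr p) (ratr q))); last by ring.
by rewrite (le_lt_trans (ler_normB _ _))// [ltRHS]splitr ltrD.
Qed.

Lemma raddE x y : toR (radd x y) = toR x + toR y.
Proof.
apply: (@real_op_ext radd +%R +%R) => [r e e0|a b e e0||].
- have [_ /(_ e e0)[d d0 D]] := proj1 MPET (FAdd (BV (VY YR))) r.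
  exists d => // u v u' v' ur vr u'r v'r uu vv.
  exact: (D (u, (v, tt)) (u', (v', tt))).
- exists (e / 2); first by rewrite divr_gt0.
  move=> a' b' aa bb; rewrite opprD addrACA (le_lt_trans (ler_normD _ _))//.
  by rewrite [ltRHS]splitr ltrD.
- exact: radd_cst.
- exact: rmorphD.
Qed.

Lemma rmulE x y : toR (rmul x y) = toR x * toR y.
Proof.
apply: (@real_op_ext rmul *%R *%R) => [r e e0|a b e e0||].
- have [_ /(_ e e0)[d d0 D]] := proj1 MPET (FScale (BV (VY YR))) r.
  exists d => // u v u' v' ur vr u'r v'r uu vv.
  exact: (D (u, (v, tt)) (u', (v', tt))).
(* The product changes by at most [e / s * (|a| + |b| + 1)], which is less than [e]. *)
- pose s := `|a| + `|b| + 2.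
  have s0 : 0 < s by rewrite ltr_wpDl// addr_ge0.
  have D0 : 0 < e / s by rewrite divr_gt0.
  exists (Num.min 1 (e / s)); first by rewrite lt_min ltr01.
  move=> a' b'; rewrite !lt_min => /andP[a1 /ltW ae] /andP[b1 /ltW be].
  rewrite (_ : _ - _ = (a - a') * b + a' * (b - b')); last by ring.
  rewrite (le_lt_trans (ler_normD _ _))// !normrM.
  have a's : `|a'| <= `|a| + 1.
    by rewrite -[a'](subKr a) (le_trans (ler_normB _ _))// lerD2l ltW.
  have := ler_wpM2r (normr_ge0 b) ae; have := ler_pM (normr_ge0 _) (normr_ge0 _) a's be.
  have : e = e / s * s by rewrite divfK// gt_eqF.
  by move: D0; rewrite /s; lra.
- exact: rmul_cst.
- exact: rmorphM.
Qed.
End AbstractPET.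

(** The proof is a parameter of the type because the module structure declared on it rests on that
    proof. *)
Definition pet_hilbert (R : realType) (M : prestructure R PET_language)
  (MPET : PET_structure M) : Type := M sH.

(** * The inner product space of an abstract PET structure *)

Section PETHilbert.
Context {R : realType} (M : prestructure R PET_language) (MPET : PET_structure M).
Notation V := (pet_hilbert MPET).

Lemma rcst_ofR q : rcst M q = ofR M (ratr q).
Proof. by rewrite -(rcstE MPET) toRK. Qed.

Let opp (x : V) : V := hscale (rcst M (-1)) x.
Let scale (a : R) (x : V) : V := hscale (ofR M a) x.

Let oppK : left_inverse (hzero M : V) opp (@hadd R M).
Proof. exact: haddN. Qed.

HB.instance Definition _ := Choice.copy V (M sH).
HB.instance Definition _ := GRing.isZmodule.Build V
  (haddA MPET) (haddC MPET) (hadd0 MPET) oppK.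

Let scalA a b x : scale a (scale b x) = scale (a * b) x.
Proof.
rewrite /scale (hscaleA MPET); congr hscale.
by apply: (can_inj (@toRK _ _ M)); rewrite (rmulE MPET) !ofRK.
Qed.
Let scal1 x : scale 1 x = x.
Proof. by rewrite -[RHS](hscale1 MPET) rcst_ofR rmorph1. Qed.
Let scalDr : right_distributive scale +%R.
Proof. by move=> a x y; exact: hscaleDr. Qed.
Let scalDl x : {morph scale^~ x : a b / a + b}.
Proof.
move=> a b; rewrite -[RHS](hscaleDl MPET); congr hscale.
by apply: (can_inj (@toRK _ _ M)); rewrite (raddE MPET) !ofRK.
Qed.
HB.instance Definition _ := GRing.Zmodule_isLmodule.Build R V scalA scal1 scalDr scalDl.

Let pip (x y : V) : R := toR (hinner x y).
Let pipC x y : pip x y = pip y x.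
Proof. by rewrite /pip (hinnerC MPET). Qed.
Let pipDl x y z : pip (x + y) z = pip x z + pip y z.
Proof. by rewrite -(raddE MPET) -(hinnerDl MPET). Qed.
Let pipZl a x y : pip (a *: x) y = a * pip x y.
Proof. by rewrite /pip -[a in RHS](ofRK M) -(rmulE MPET) -(hinnerZl MPET). Qed.
Let pip_ge0 x : 0 <= pip x x.
Proof. by rewrite /pip (hinner_norm MPET) (rmulE MPET) -expr2 sqr_ge0. Qed.

Definition pet_ip : ipSpace R := IpSpace pipC pipDl pipZl pip_ge0.

Lemma nrm_pet (x : pet_ip) : nrm x = toR (hnorm (x : M sH)).
Proof.
rewrite /nrm /= /pip (hinner_norm MPET) (rmulE MPET) -expr2 sqrtr_sqr.
by rewrite ger0_norm// (hnorm_ge0 MPET).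
Qed.

Lemma mdist_pet (x y : M sH) : mdist x y = nrm ((x : pet_ip) - (y : pet_ip)).
Proof. by rewrite nrm_pet (hdist MPET). Qed.

(** Restriction to the standard integers, at which the averages with standard [n] are formed. *)
Definition seq_op (U : M PZ -> M sB) (j : int) : pet_ip -> pet_ip :=
  bapp (U (icst M (CZ j))).
Definition seq_adj (U : M PZ -> M sB) (j : int) : pet_ip -> pet_ip :=
  bapp (ifun M FAdj (U (icst M (CZ j)))).

Lemma bapp_linear (S : M sB) : linear (bapp S : pet_ip -> pet_ip).
Proof. by move=> a x y; exact: bapp_lin. Qed.

Lemma unitary_seq_pet (U : M PZ -> M sB) :
  (forall i, ifun M FComp (ifun M FAdj (U i)) (U i) = icst M CId /\
    ifun M FComp (U i) (ifun M FAdj (U i)) = icst M CId) ->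
  unitary_seq (seq_op U) (seq_adj U).
Proof.
move=> uU; split=> j.
- exact: bapp_linear.
- exact: bapp_linear.
- by move=> x y; rewrite /= /pip (bapp_adj MPET).
- by move=> x; rewrite /seq_adj -(bapp_comp MPET) (proj1 (uU _)) (bapp_id MPET).
- by move=> x; rewrite /seq_op -(bapp_comp MPET) (proj2 (uU _)) (bapp_id MPET).
Qed.

(** [foldl] applies the head of the tuple first, so the head matches the first difference taken in
    [leibman], with a standard step. *)
Lemma leibman_pet k (U : M PZ -> M sB) :
  (forall (s : k.-tuple (M PZ)) (j : M PZ),
     foldl (fun U i => Delta i U) U s j = icst M CId) ->
  leibman k (seq_op U) (seq_adj U).
Proof.
elim: k U => [|k IHk] U lU /=.
  by move=> j x; rewrite -[RHS](bapp_id MPET); congr bapp; exact: (lU [tuple]).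
move=> i; have := IHk (Delta (icst M (CZ i)) U).
have -> : seq_op (Delta (icst M (CZ i)) U) = fun j => seq_op U (i + j) \o seq_adj U j.
  apply/funext => j; apply/funext => x.
  by rewrite /seq_op /Delta (bapp_comp MPET) (zadd_cst MPET).
have -> : seq_adj (Delta (icst M (CZ i)) U) = fun j => seq_op U j \o seq_adj U (i + j).
  apply/funext => j; apply/funext => x.
  by rewrite /seq_adj /Delta (bapp_adj_comp MPET) (zadd_cst MPET).
by apply=> s j; exact: (lU [tuple of icst M (CZ i) :: s] j).
Qed.

Lemma AV_avg (T : M (sL XZ YB)) n (x : M sH) :
  ifun M FApp (AV (icst M (CN n)) T) x = avg n (seq_op (opseq T)) (x : pet_ip).
Proof.
elim: n => [|n IHn].
  by rewrite /avg big_ord1 invr1 scale1r; exact: (AV0 MPET).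
transitivity ((n.+1%:R / n.+2%:R) *: avg n (seq_op (opseq T)) (x : pet_ip)
    + n.+2%:R^-1 *: seq_op (opseq T) n.+1%:Z (x : pet_ip)).
  rewrite [LHS](AVS MPET) [bapp _ x in X in hadd X _]IHn.
  by rewrite !rcst_ofR rmorphM !fmorphV !rmorph_nat.
by rewrite /avg [in RHS]big_ord_recr scalerDr scalerA mulrAC mulfV ?mul1r//.
Qed.
End PETHilbert.

(** * The metastability rate *)

Theorem theorem3 (R : realType) (d : nat) :
  exists E : metastability_rate R,
    forall (M : prestructure R PET_language) (x : M sH) (T : M (sL XZ YB)),
      PET_structure M -> unit_ball x -> unitary_Leibman d T ->
      rate_applies E
        (fun n : nat => ifun M FApp (AV (icst M (CN n)) T) x : M sH).
Proof.
(* The window from [i] to [F eta i] contains the sample [eta i]. *)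
pose F (eta : sampling) i := \max_(j <- eta i) j.
(* The bound is chosen before any structure; degree at most [d] means [d + 1] differences, hence
   [leibman d.+1]. *)
have /choice[N NP] : forall p : {posnum R} * sampling, exists N : nat,
    forall (W : ipSpace R) (T S : int -> W -> W) (x : W),
      unitary_seq T S -> leibman d.+1 T S -> nrm x <= 1 ->
      exists2 i, (i <= N)%N & osc_lt T x i (F p.2 i) p.1%:num.
  by move=> p; exact: leibman_uniformly_metastable.
(* The rate is the initial segment up to [N (e, eta)], which contains 0. *)
have N0 e eta : [fset i | i in iota 0 (N (e, eta)).+1]%fset != fset0.
  by apply/fset0Pn; exists 0%N; rewrite !inE.
exists (MetastabilityRate N0) => M x T MPET x1 [uT lT] e eta.
have [|i iN osc] := NP (e, eta) (pet_ip MPET) _ _ x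
  (unitary_seq_pet MPET uT) (leibman_pet MPET lT).
  by rewrite nrm_pet.
exists i; first by apply/imfsetP; exists i; rewrite // [_ \in _]mem_iota.
have in_window j : j \in eta i -> (i <= j <= F eta i)%N.
  by move=> ji; rewrite (sampling_ge ji) /F leq_bigmax_seq.
rewrite big_seq; apply: bigmax_lt => // a ai.
rewrite big_seq; apply: bigmax_lt => // b bi.
by rewrite (mdist_pet MPET) !AV_avg; apply: osc; exact: in_window.
Qed.
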